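(* Let $k\ge 1$ and let $n_1,\dots,n_k\ge 1$ be integers. Every uniform lattice in the product $SO(n_1,1)\times\dots\times SO(n_k,1)$ is medianizable.
   Context: A median space is a metric space $(\mathcal M,d)$ such that for every triple of points $x_1,x_2,x_3$ there is a unique point $m$ with $d(x_i,m)+d(m,x_j)=d(x_i,x_j)$ for all $i\ne j$. A group is medianizable if it acts geometrically, i.e. by isometries, properly discontinuously and cocompactly, on a median space. A uniform lattice is a discrete subgroup with compact quotient. *)

(* Defs.v *)
From HB Require Import structures.
From mathcomp Require Import all_boot all_order all_algebra generic_quotient.
From mathcomp Require Import all_classical all_reals all_analysis.

Set Implicit Arguments.
Unset Strict Implicit.
Unset Printing Implicit Defensive.

Import Order.TTheory GRing.Theory Num.Theory.
Import numFieldNormedType.Exports.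

Local Open Scope classical_set_scope.
Local Open Scope ring_scope.

HB.mixin Record isTopGroup G of Group G & Topological G := {
  mulg_continuous : continuous (fun x : G * G => (x.1 * x.2)%g);
  invg_continuous : continuous (fun x : G => x^-1%g)
}.

#[short(type="topGroupType")]
HB.structure Definition TopGroup :=
  {G of Group G & Topological G & isTopGroup G}.

Definition subgroup (G : groupType) (S : groupClosed G) : Type :=
  {x : G | x \in S}.

Section Subgroup.
Context {G : groupType} (S : groupClosed G).

HB.instance Definition _ := SubChoice.copy (subgroup S) {x : G | x \in S}.

Fact subgroup_closed : group_closed S.
Proof.
by split; [exact: gpred1|move=> x y xS yS; apply: gpredM; rewrite ?gpredV].
Qed.

HB.instance Definition _ :=
  SubChoice_isSubGroup.Build G _ (subgroup S) subgroup_closed.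

End Subgroup.

Section Coset.
Context {G : groupType} (S : groupClosed G).

Definition coset_rel : rel G := [rel x y | (x^-1 * y)%g \in S].

Fact coset_rel_refl : reflexive coset_rel.
Proof. by move=> x; rewrite /coset_rel /= mulVg gpred1. Qed.

Fact coset_rel_sym : symmetric coset_rel.
Proof. by move=> x y; rewrite /coset_rel /= -gpredV invgM invgK. Qed.

Fact coset_rel_trans : transitive coset_rel.
Proof.
move=> y x z; rewrite /coset_rel /= => xy yz.
by have := gpredM _ _ xy yz; rewrite mulgA mulgK.
Qed.

Canonical coset_equiv :=
  EquivRel coset_rel coset_rel_refl coset_rel_sym coset_rel_trans.

End Coset.

Definition coset_space (G : topGroupType) (S : groupClosed G) :=
  quotient_topology {eq_quot (coset_equiv S)}%qT.

Definition uniform_lattice (G : topGroupType) (S : groupClosed G) : Prop :=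
  [set` S] `<=` isolated [set` S] /\ compact [set: coset_space S].

Section SO.
Context (R : realType) (n : nat).

Definition lorentz_form : 'M[R]_n.+1 :=
  diag_mx (\row_i (if i == ord_max then -1 else 1)).

Definition SO_set : set 'M[R]_n.+1 :=
  [set A | A^T *m lorentz_form *m A = lorentz_form /\ \det A = 1].

Definition SO : Type := set_type SO_set.

HB.instance Definition _ := SubChoice.copy SO (set_type SO_set).
HB.instance Definition _ := Topological.copy SO (set_type SO_set).

Implicit Types A B : 'M[R]_n.+1.

Fact SO_set1 : SO_set 1%:M.
Proof. by split; rewrite ?det1// trmx1 mul1mx mulmx1. Qed.

Fact SO_setM A B : SO_set A -> SO_set B -> SO_set (A *m B).
Proof.
move=> [AJ dA] [BJ dB]; split; last by rewrite det_mulmx dA dB mulr1.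
rewrite trmx_mul -!mulmxA (mulmxA lorentz_form) (mulmxA A^T) (mulmxA A^T) AJ.
by rewrite mulmxA.
Qed.

Fact SO_set_unit A : SO_set A -> A \in unitmx.
Proof. by move=> [_ dA]; rewrite unitmxE dA unitr1. Qed.

Fact SO_setV A : SO_set A -> SO_set (invmx A).
Proof.
move=> SA; have uA := SO_set_unit SA; case: SA => AJ dA.
split; last by rewrite det_inv dA invr1.
rewrite -[in LHS]AJ trmx_inv !mulmxA mulVmx ?unitmx_tr// mul1mx.
by rewrite -mulmxA mulmxV// mulmx1.
Qed.

Definition SO_one : SO := SigSub (mem_set SO_set1).
Definition SO_mul (A B : SO) : SO :=
  SigSub (mem_set (SO_setM (set_valP A) (set_valP B))).
Definition SO_inv (A : SO) : SO := SigSub (mem_set (SO_setV (set_valP A))).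

Fact SO_mulA : associative SO_mul.
Proof. by move=> A B C; apply: val_inj; rewrite /= mulmxA. Qed.

Fact SO_mul1 : left_id SO_one SO_mul.
Proof. by move=> A; apply: val_inj; rewrite /= mul1mx. Qed.

Fact SO_mulr1 : right_id SO_one SO_mul.
Proof. by move=> A; apply: val_inj; rewrite /= mulmx1. Qed.

Fact SO_mulV : left_inverse SO_one SO_inv SO_mul.
Proof.
by move=> A; apply: val_inj; rewrite /= mulVmx// SO_set_unit//; exact: set_valP.
Qed.

Fact SO_mulrV : right_inverse SO_one SO_inv SO_mul.
Proof.
by move=> A; apply: val_inj; rewrite /= mulmxV// SO_set_unit//; exact: set_valP.
Qed.

HB.instance Definition _ :=
  isGroup.Build SO SO_mulA SO_mul1 SO_mulr1 SO_mulV SO_mulrV.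

Fact lorentz_form_sqr : lorentz_form *m lorentz_form = 1%:M.
Proof.
rewrite mulmx_diag -diag_const_mx; congr diag_mx; apply/rowP => i.
by rewrite !mxE; case: ifP => _; rewrite ?mulrNN mulr1.
Qed.

Fact SO_inv_form (A : SO) :
  val (A^-1)%g = lorentz_form *m (val A)^T *m lorentz_form.
Proof.
have SA := set_valP A; have [AJ _] := SA.
have JA : lorentz_form *m (val A)^T *m lorentz_form *m val A = 1%:M.
  by rewrite -!mulmxA (mulmxA (val A)^T) AJ lorentz_form_sqr.
by rewrite -[RHS](mulmxK (SO_set_unit SA)) JA mul1mx.
Qed.

Let continuous_mx (T : topologicalType) (f : T -> 'M[R]_n.+1) :
  (forall i j, continuous (fun x => f x i j)) -> continuous f.
Proof.
move=> cf x U [P PM sPU].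
apply: (filterS (P := [set y | forall i j, P i j (f y i j)])).
  by move=> y Py; exact: sPU.
by apply: filter_forall => i; apply: filter_forall => j; exact: cf.
Qed.

Let val_continuous : continuous (val : SO -> 'M[R]_n.+1).
Proof. exact: initial_continuous. Qed.

Let entry_continuous i j : continuous (fun A : SO => val A i j).
Proof.
move=> A; apply: (@continuous_comp _ _ _ (val : SO -> _) (fun M => M i j)).
  exact: val_continuous.
exact: coord_continuous.
Qed.

Let sum_continuous (T : topologicalType) (F : 'I_n.+1 -> T -> R) :
  (forall k, continuous (F k)) -> continuous (fun x => \sum_k F k x).
Proof. by move=> cF; apply: continuous_big => // x; exact: add_continuous. Qed.

Fact SO_mul_continuous : continuous (fun x : SO * SO => (x.1 * x.2)%g).
Proof.
apply: (@continuous_comp_initial _ _ _ (set_val : SO_set -> _)).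
apply: continuous_mx => i j.
rewrite (_ : (fun _ => _) =
  fun x : SO * SO => \sum_k val x.1 i k * val x.2 k j); last first.
  by apply/funext => x; rewrite /= mxE.
apply: sum_continuous => k x; apply: cvgM.
  apply: (@continuous_comp _ _ _ fst (fun A : SO => val A i k)).
    exact: cvg_fst.
  exact: entry_continuous.
apply: (@continuous_comp _ _ _ snd (fun A : SO => val A k j)).
  exact: cvg_snd.
exact: entry_continuous.
Qed.

Fact SO_inv_continuous : continuous (fun A : SO => (A^-1)%g).
Proof.
apply: (@continuous_comp_initial _ _ _ (set_val : SO_set -> _)).
apply: continuous_mx => i j.
pose s := fun i : 'I_n.+1 => if i == ord_max then -1 else 1 : R.
rewrite (_ : (fun _ => _) = fun A : SO => s i * val A j i * s j).
  move=> A.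
  apply: (@continuousM _ _ (fun A : SO => s i * val A j i) (cst (s j))).
    apply: (@continuousM _ _ (cst (s i))); last exact: entry_continuous.
    exact: cst_continuous.
  exact: cst_continuous.
apply/funext => A /=; rewrite -[LHS]/(val (A^-1)%g i j) SO_inv_form.
by rewrite mul_mx_diag mxE mul_diag_mx !mxE.
Qed.

HB.instance Definition _ :=
  isTopGroup.Build SO SO_mul_continuous SO_inv_continuous.

End SO.

Section GroupProd.
Context {I : eqType} (G : I -> topGroupType).

Definition group_prod : Type := prod_topology G.

HB.instance Definition _ := Topological.copy group_prod (prod_topology G).

Definition group_prod_one : group_prod := fun=> 1%g.
Definition group_prod_inv (x : group_prod) : group_prod := fun i => (x i)^-1%g.
Definition group_prod_mul (x y : group_prod) : group_prod :=
  fun i => (x i * y i)%g.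

Fact group_prod_mulA : associative group_prod_mul.
Proof.
by move=> x y z; apply: functional_extensionality_dep => i; exact: mulgA.
Qed.

Fact group_prod_mul1 : left_id group_prod_one group_prod_mul.
Proof.
by move=> x; apply: functional_extensionality_dep => i; exact: mul1g.
Qed.

Fact group_prod_mulr1 : right_id group_prod_one group_prod_mul.
Proof.
by move=> x; apply: functional_extensionality_dep => i; exact: mulg1.
Qed.

Fact group_prod_mulV :
  left_inverse group_prod_one group_prod_inv group_prod_mul.
Proof.
by move=> x; apply: functional_extensionality_dep => i; exact: mulVg.
Qed.

Fact group_prod_mulrV :
  right_inverse group_prod_one group_prod_inv group_prod_mul.
Proof.
by move=> x; apply: functional_extensionality_dep => i; exact: mulgV.
Qed.

HB.instance Definition _ := isGroup.Build group_prod group_prod_mulA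
  group_prod_mul1 group_prod_mulr1 group_prod_mulV group_prod_mulrV.

Let continuous_prod (T : topologicalType) (f : T -> group_prod) :
  (forall i, continuous (fun x => f x i)) -> continuous f.
Proof.
move=> cf x; apply/cvg_sup => i.
exact: (@continuous_comp_initial _ _ _ (fun g : group_prod => g i) f (cf i)).
Qed.

Let coordinate_continuous i : continuous (fun x : group_prod => x i).
Proof. exact: proj_continuous. Qed.

Fact group_prod_mul_continuous :
  continuous (fun x : group_prod * group_prod => (x.1 * x.2)%g).
Proof.
apply: continuous_prod => i x.
apply: (@continuous_comp _ _ _
  (fun x : group_prod * group_prod => (x.1 i, x.2 i))
  (fun y : G i * G i => (y.1 * y.2)%g)); last exact: mulg_continuous.
apply: cvg_pair.
  apply: (@continuous_comp _ _ _ fst (fun x : group_prod => x i)).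
    exact: cvg_fst.
  exact: coordinate_continuous.
apply: (@continuous_comp _ _ _ snd (fun x : group_prod => x i)).
  exact: cvg_snd.
exact: coordinate_continuous.
Qed.

Fact group_prod_inv_continuous : continuous (fun x : group_prod => x^-1%g).
Proof.
apply: continuous_prod => i x.
apply: (@continuous_comp _ _ _ (fun x : group_prod => x i)
  (fun y : G i => y^-1%g)); first exact: coordinate_continuous.
exact: invg_continuous.
Qed.

HB.instance Definition _ := isTopGroup.Build group_prod
  group_prod_mul_continuous group_prod_inv_continuous.

End GroupProd.

Definition SO_prod (R : realType) (k : nat) (n : 'I_k -> nat) : topGroupType :=
  group_prod (fun i => SO R (n i)).

(* The empty set is excluded: every group acts on it geometrically. *)
Definition median_space (R : realType) (M : metricType R) : Prop :=
  [set: M] !=set0 /\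
  forall x : 'I_3 -> M, exists! m : M, forall i j : 'I_3, i != j ->
    mdist (x i) m + mdist m (x j) = mdist (x i) (x j).

Section Actions.
Context {R : realType} {G : groupType} {M : metricType R}.
Implicit Types act : G -> M -> M.

Definition is_group_action act : Prop :=
  act 1%g = id /\ forall g h : G, act (g * h)%g = act g \o act h.

Definition isometric act : Prop :=
  forall (g : G) (x y : M), mdist (act g x) (act g y) = mdist x y.

Definition properly_discontinuous act : Prop :=
  forall K : set M, compact K ->
    finite_set [set g : G | (act g @` K) `&` K !=set0].

Definition cocompact act : Prop :=
  exists2 K : set M, compact K & \bigcup_g (act g @` K) = [set: M].

Definition geometric_action act : Prop :=
  [/\ is_group_action act, isometric act, properly_discontinuous act
    & cocompact act].

End Actions.

Definition medianizable (R : realType) (G : groupType) : Prop :=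
  exists (M : metricType R) (act : G -> M -> M),
    median_space M /\ geometric_action act.

(* Main.v *)
Require Import Defs.
From HB Require Import structures.
From mathcomp Require Import all_boot all_order all_algebra generic_quotient.
From mathcomp Require Import finmap.
From mathcomp Require Import all_classical all_reals all_analysis.
From mathcomp Require Import ring lra zify.

(** A wall of hyperbolic space [H^n] is the orthogonal complement of a spacelike
    vector of Minkowski space [R^(n,1)], and by Crofton's formula the hyperbolic
    distance of two points is the invariant measure of the set of walls that
    separate them. A point [x] is encoded by the walls through it, which form
    the spacelike hyperplane orthogonal to [x]; a vector on the future side of
    this hyperplane is a half-space of [H^n] on a fixed side of [x]. The points
    of the median space are hypersurfaces that share the properties of these
    hyperplanes except linearity: they are zero sets of a [time_function], that
    is, homogeneous and odd graphs over space that are never steeper than the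
    light cone, and they are bounded away from the light cone ([pinched]). Such
    functions are closed under pointwise medians. The distance [hdist] is the
    volume of the region enclosed by two of them within the slab of vectors of
    square length at most [1], with a cut-off, and the distance in a product is
    the sum over the factors.

    In this [L^1] distance, equality in the triangle inequality means pointwise
    betweenness ([hdist_btw], [hdist_btw_inv]), because an open set of vectors
    has positive volume ([avg_lower]). Hence pointwise medians are medians and
    they are unique ([model_median]).

    The volume is the asymptotic density of lattice points, taken along an
    ultrafilter so that no limit has to be shown to exist. It is invariant under
    the Lorentz group for an elementary reason. A matrix of determinant [1] is a
    product of shears, hence moves the points of [Z^(n+1)] like a bijection of
    [Z^(n+1)] up to a bounded error ([det1_almost_permutation]). Such an error
    affects only lattice points near the two zero sets, and there are [O(N^n)]
    of these among the [O(N^(n+1))] points at scale [N] ([shell_sum]). This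
    gives [hdist_act].

    For cocompactness, the functions with a given pinching constant form a
    compact set, by pointwise limits and a Lipschitz bound
    ([model_ball_compact]), and the group moves every point of the model into a
    fixed set of this kind ([tf_act_center]). Indeed two vectors of a zero set
    never differ by a timelike vector, so any two walls in it meet or are
    asymptotic, and the projection of the base point to the farthest wall is
    close to all of them ([tf_center]). A uniform lattice meets every coset of
    the product group in elements with bounded entries ([cocompact_bounded]),
    hence the lattice moves every point of the model into one compact set as
    well.

    For properness, a compact set of the model has a common pinching constant
    ([compact_model_ball]). A group element that moves one pinched point to
    another has bounded entries ([tf_act_proper]), and a discrete group contains
    finitely many such elements ([discrete_bounded_finite]). *)

Set Implicit Arguments.
Unset Strict Implicit.
Unset Printing Implicit Defensive.

Import Order.TTheory GRing.Theory Num.Theory.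
Import numFieldNormedType.Exports.

Local Open Scope classical_set_scope.
Local Open Scope ring_scope.

(** * Minkowski space and the Lorentz group *)

Section Minkowski.
Context {R : realType} {n : nat}.
Implicit Types (u v w x y : 'cV[R]_n.+1) (a b r : R).

Definition tm v : R := v ord_max 0.
Definition ip v w : R := \sum_(i | i != ord_max) v i 0 * w i 0.
Definition ldot v w : R := ip v w - tm v * tm w.
(** The square of the Euclidean norm. *)
Definition enorm v : R := ip v v + tm v ^+ 2.
Definition tvec : 'cV[R]_n.+1 := \col_i (if i == ord_max then 1 else 0).

Lemma tmD v w : tm (v + w) = tm v + tm w. Proof. by rewrite /tm mxE. Qed.
Lemma tmZ a v : tm (a *: v) = a * tm v. Proof. by rewrite /tm mxE. Qed.
Lemma tmN v : tm (- v) = - tm v. Proof. by rewrite /tm mxE. Qed.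
Lemma tm0 : tm 0 = 0. Proof. by rewrite /tm mxE. Qed.
Lemma tm_tvec : tm tvec = 1. Proof. by rewrite /tm mxE eqxx. Qed.

Lemma ipC v w : ip v w = ip w v.
Proof. by apply: eq_bigr => i _; rewrite mulrC. Qed.

Lemma ipDl u v w : ip (u + v) w = ip u w + ip v w.
Proof. by rewrite -big_split; apply: eq_bigr => i _; rewrite mxE mulrDl. Qed.

Lemma ipZl a v w : ip (a *: v) w = a * ip v w.
Proof. by rewrite /ip mulr_sumr; apply: eq_bigr => i _; rewrite mxE mulrA. Qed.

Lemma ipDr u v w : ip w (u + v) = ip w u + ip w v.
Proof. by rewrite ipC ipDl !(ipC w). Qed.

Lemma ipZr a v w : ip w (a *: v) = a * ip w v.
Proof. by rewrite ipC ipZl (ipC w). Qed.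

Lemma ip_tvec v : ip tvec v = 0.
Proof. by apply: big1 => i /negPf ni; rewrite mxE ni mul0r. Qed.

Lemma ip_ge0 v : 0 <= ip v v.
Proof. by apply: sumr_ge0 => i _; rewrite -expr2 sqr_ge0. Qed.

Lemma sum_CauchySchwarz (I : finType) (P : pred I) (f g : I -> R) :
  (\sum_(i | P i) f i * g i) ^+ 2 <=
  (\sum_(i | P i) f i ^+ 2) * \sum_(i | P i) g i ^+ 2.
Proof.
set p := \sum_(i | P i) _; set F := \sum_(i | P i) f i ^+ 2.
set G := \sum_(i | P i) _.
have H a b : 0 <= a ^+ 2 * F + 2 * a * b * p + b ^+ 2 * G.
  have -> : a ^+ 2 * F + 2 * a * b * p + b ^+ 2 * G =
      \sum_(i | P i) (a * f i + b * g i) ^+ 2.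
    rewrite !mulr_sumr -!big_split; apply: eq_bigr => i _ /=; ring.
  by apply: sumr_ge0 => i _; exact: sqr_ge0.
have : 0 <= G by apply: sumr_ge0 => i _; exact: sqr_ge0.
rewrite le_eqVlt => /orP[/eqP G0|G0]; last by have := H G (- p); nra.
(* If [g] vanishes, the quadratic polynomial [H 1] is affine and nonnegative. *)
rewrite -G0 mulr0; suff -> : p = 0 by rewrite expr0n.
apply/eqP; apply/negPn/negP => p0.
have := H 1 (- (F + 1) / (2 * p)).
have -> : 1 ^+ 2 * F + 2 * 1 * (- (F + 1) / (2 * p)) * p = -1 by field.
by rewrite -G0 mulr0 addr0; lra.
Qed.

Lemma ip_CauchySchwarz v w : ip v w ^+ 2 <= ip v v * ip w w.
Proof. by rewrite sum_CauchySchwarz. Qed.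

Lemma ldotC v w : ldot v w = ldot w v.
Proof. by rewrite /ldot ipC (mulrC (tm v)). Qed.

Lemma ldotDl u v w : ldot (u + v) w = ldot u w + ldot v w.
Proof. by rewrite /ldot ipDl tmD; ring. Qed.

Lemma ldotZl a v w : ldot (a *: v) w = a * ldot v w.
Proof. by rewrite /ldot ipZl tmZ; ring. Qed.

Lemma ldotNl v w : ldot (- v) w = - ldot v w.
Proof. by rewrite -scaleN1r ldotZl mulN1r. Qed.

Lemma ldotDr u v w : ldot w (u + v) = ldot w u + ldot w v.
Proof. by rewrite ldotC ldotDl !(ldotC w). Qed.

Lemma ldotZr a v w : ldot w (a *: v) = a * ldot w v.
Proof. by rewrite ldotC ldotZl (ldotC w). Qed.

Lemma ldotNr v w : ldot w (- v) = - ldot w v.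
Proof. by rewrite ldotC ldotNl (ldotC w). Qed.

Lemma ldot_tvec v : ldot tvec v = - tm v.
Proof. by rewrite /ldot ip_tvec tm_tvec; ring. Qed.

Lemma ldot_tvecr v : ldot v tvec = - tm v.
Proof. by rewrite ldotC ldot_tvec. Qed.

Definition ldotE :=
  (ldotDl, ldotDr, ldotZl, ldotZr, ldotNl, ldotNr, ldot_tvec, ldot_tvecr,
   tmD, tmZ, tmN, tm_tvec).

Lemma enorm_ldot v : enorm v = ldot v v + 2 * tm v ^+ 2.
Proof. by rewrite /enorm /ldot; ring. Qed.

Lemma enorm_ge0 v : 0 <= enorm v.
Proof. by rewrite addr_ge0 ?ip_ge0 ?sqr_ge0. Qed.

Lemma enormE v : enorm v = \sum_i v i 0 ^+ 2.
Proof. by rewrite (bigD1 ord_max) //= addrC. Qed.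

Lemma coord_enorm v i : v i 0 ^+ 2 <= enorm v.
Proof.
by rewrite enormE (bigD1 i) //= lerDl sumr_ge0// => j _; rewrite sqr_ge0.
Qed.

Lemma enorm_eq0 v : enorm v <= 0 -> v = 0.
Proof.
move=> v0; apply/colP => i; rewrite mxE; apply/eqP.
rewrite -[_ == 0](expf_eq0 _ 2) eq_le sqr_ge0 andbT.
exact: le_trans (coord_enorm v i) v0.
Qed.

Lemma enormZ a v : enorm (a *: v) = a ^+ 2 * enorm v.
Proof. by rewrite /enorm ipZl ipZr tmZ; ring. Qed.

Definition cone v := (0 <= tm v) /\ (ldot v v <= 0).

Lemma cone_tvec : cone tvec.
Proof. by split; rewrite ?ldot_tvec tm_tvec// lerN10. Qed.

Lemma coneZ a v : 0 <= a -> cone v -> cone (a *: v).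
Proof.
move=> a0 [v0 vv]; split; first by rewrite tmZ mulr_ge0.
by rewrite ldotZl ldotZr mulrA -expr2 mulr_ge0_le0// sqr_ge0.
Qed.

(** The reversed Cauchy-Schwarz inequality: for causal vectors the product of
    the times dominates the product of the space parts. *)
Lemma cone_ldot_le0 v w : cone v -> cone w -> ldot v w <= 0.
Proof.
move=> [v0 vv] [w0 ww]; rewrite /ldot subr_le0.
have vv' : ip v v <= tm v ^+ 2 by move: vv; rewrite /ldot; lra.
have ww' : ip w w <= tm w ^+ 2 by move: ww; rewrite /ldot; lra.
have := le_trans (ip_CauchySchwarz v w) (ler_pM (ip_ge0 v) (ip_ge0 w) vv' ww').
rewrite -exprMn => H.
have [p0|p0] := leP 0 (ip v w); last by apply: ltW; apply: lt_le_trans p0 _;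
  exact: mulr_ge0.
by rewrite -(ler_pXn2r (ltn0Sn 1)) ?nnegrE// mulr_ge0.
Qed.

Lemma causal_eq0 v : ldot v v <= 0 -> tm v = 0 -> v = 0.
Proof. by move=> vv t0; apply: enorm_eq0; rewrite enorm_ldot t0; lra. Qed.

(** A timelike future vector stays in the cone after a small step back in time;
    this upgrades monotonicity along the cone to strict monotonicity along
    timelike directions. *)
Lemma cone_timelike v : ldot v v < 0 -> 0 < tm v ->
  exists2 r, 0 < r & cone (v - r *: tvec).
Proof.
move=> vv v0; exists (- ldot v v / (2 * tm v)).
  by rewrite divr_gt0 ?oppr_gt0// mulr_gt0.
have e : - ldot v v / (2 * tm v) * tm v = - ldot v v / 2 by field;
  rewrite gt_eqF.
have r0 : 0 < - ldot v v / (2 * tm v) by rewrite divr_gt0 ?oppr_gt0// mulr_gt0.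
have lt : - ldot v v <= tm v ^+ 2.
  by rewrite /ldot opprB -expr2 gerBl ip_ge0.
set r := _ / _ in e r0 *.
split; rewrite !ldotE.
  have : r * tm v <= tm v * tm v by rewrite e; nra.
  rewrite ler_pM2r//; lra.
nra.
Qed.

(** Waiting long enough brings any vector into the future cone; this turns
    monotonicity along the cone into a Lipschitz bound. *)
Lemma cone_wait v r : tm v ^+ 2 + ip v v <= r ^+ 2 -> 0 <= r ->
  cone (v + (2 * r) *: tvec).
Proof.
move=> vr r0; have t1 : `|tm v| <= r.
  rewrite -(ler_pXn2r (ltn0Sn 1)) ?nnegrE// real_normK ?num_real//.
  by apply: le_trans vr; rewrite lerDl ip_ge0.
move: t1; rewrite ler_norml => /andP[t1 t2].
split; first by rewrite !ldotE; lra.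
rewrite !ldotE /ldot; have := ip_ge0 v; nra.
Qed.

Section Isometries.
Implicit Types A B : 'M[R]_n.+1.

Lemma ldot_mx v w : ldot v w = (v^T *m lorentz_form R n *m w) 0 0.
Proof.
rewrite mul_mx_diag mxE (bigD1 ord_max)//= addrC; congr (_ + _).
  apply: eq_bigr => i /negPf ni; rewrite !mxE ni; ring.
by rewrite !mxE eqxx /tm; ring.
Qed.

Definition lorentz A := forall v w, ldot (A *m v) (A *m w) = ldot v w.

Lemma lorentzP A : lorentz A <->
  A^T *m lorentz_form R n *m A = lorentz_form R n.
Proof.
split=> [LA|AJ v w]; last first.
  by rewrite !ldot_mx trmx_mul -!mulmxA (mulmxA _ A) (mulmxA A^T) (mulmxA A^T)
    AJ.
have entry (B : 'M[R]_n.+1) i j :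
    ((delta_mx i 0 : 'cV_n.+1)^T *m B *m (delta_mx j 0 : 'cV_n.+1)) 0 0 = B i j.
  by rewrite trmx_delta -rowE -colE !mxE.
apply/matrixP => i j; rewrite -entry -[RHS]entry -ldot_mx -LA ldot_mx.
by rewrite trmx_mul !mulmxA.
Qed.

Lemma lorentz_det A : lorentz A -> \det A = 1 \/ \det A = -1.
Proof.
move=> LA; have /lorentzP/(congr1 determinant) := LA.
rewrite !det_mulmx det_tr => d.
have J0 : \det (lorentz_form R n) != 0.
  have := congr1 determinant (lorentz_form_sqr R n).
  rewrite det_mulmx det1 => d1; apply/eqP => A0; move: d1.
  by rewrite A0 mulr0 => /eqP; rewrite eq_sym oner_eq0.
have : (\det A - 1) * (\det A + 1) = 0.
  apply: (mulfI J0); rewrite mulr0; move: d; set J := \det (lorentz_form R n).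
  set a := \det A; move=> d; have : a * J * a - J = 0 by rewrite d subrr.
  by move=> <-; ring.
move=> /eqP; rewrite mulf_eq0 subr_eq0 addr_eq0 => /orP[] /eqP ->;
  by [left|right].
Qed.

Lemma lorentz_mul A B : lorentz A -> lorentz B -> lorentz (A *m B).
Proof. by move=> LA LB v w; rewrite -!mulmxA LA LB. Qed.

Lemma SO_lorentz (g : SO R n) : lorentz (val g).
Proof. by apply/lorentzP; have [] := set_valP g. Qed.

(** All of [SO(n,1)] acts on the space of walls, but an element may exchange
    past and future; [hat g] is [g] or [- g], whichever preserves the future. *)
Definition hat (g : SO R n) : 'M[R]_n.+1 :=
  if 0 <= tm (val g *m tvec) then val g else - val g.

Lemma hat_lorentz g : lorentz (hat g).
Proof.
rewrite /hat; case: ifP => _; first exact: SO_lorentz.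
by move=> v w; rewrite !mulNmx ldotNl ldotNr opprK SO_lorentz.
Qed.

Lemma hat_tvec_ge0 g : 0 <= tm (hat g *m tvec).
Proof.
rewrite /hat; case: ifP => // /negbT; rewrite -ltNge => /ltW.
by rewrite mulNmx tmN oppr_ge0.
Qed.

Lemma hat_tvec_gt0 g : 0 < tm (hat g *m tvec).
Proof.
rewrite lt_neqAle hat_tvec_ge0 andbT eq_sym; apply/eqP => t0.
have := hat_lorentz g tvec tvec; rewrite ldot_tvec tm_tvec.
rewrite (@causal_eq0 (hat g *m tvec))//.
  by rewrite -(scale0r tvec) ldotZl mul0r => /esym/eqP;
    rewrite oppr_eq0 oner_eq0.
by rewrite hat_lorentz ldot_tvec tm_tvec lerN10.
Qed.

(** By the reversed Cauchy-Schwarz inequality the sign of the pairing with the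
    image of the time vector tells past from future, and this pairing is
    invariant. *)
Lemma orthochronous_cone A w :
  lorentz A -> 0 < tm (A *m tvec) -> cone w -> cone (A *m w).
Proof.
move=> LA A0 [w0 ww]; split; last by rewrite LA.
have ce : cone (A *m tvec).
  by split; [exact: ltW|rewrite LA ldot_tvec tm_tvec lerN10].
rewrite leNgt; apply/negP => wlt.
have cw : cone (- (A *m w)).
  by split; [rewrite tmN oppr_ge0 ltW|rewrite ldotNl ldotNr opprK LA].
have := cone_ldot_le0 ce cw; rewrite ldotNr LA ldot_tvec opprK => wt.
have wz : w = 0 by apply: causal_eq0 => //; apply/eqP; rewrite eq_le w0 wt.
by move: wlt; rewrite wz mulmx0 tm0 ltxx.
Qed.

Lemma hat_cone g w : cone w -> cone (hat g *m w).
Proof.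
by apply: orthochronous_cone; [exact: hat_lorentz|exact: hat_tvec_gt0].
Qed.

Lemma hat_eq g A : (A = val g \/ A = - val g) -> 0 < tm (A *m tvec) ->
  hat g = A.
Proof.
rewrite /hat => -[->|->]; first by move/ltW => ->.
by rewrite mulNmx tmN oppr_gt0 leNgt => ->.
Qed.

Lemma hat_val g : hat g = val g \/ hat g = - val g.
Proof. by rewrite /hat; case: ifP => _; [left|right]. Qed.

Lemma hatM g h : hat (g * h)%g = hat g *m hat h.
Proof.
apply: hat_eq.
  have -> : val (g * h)%g = val g *m val h by [].
  case: (hat_val g) => ->; case: (hat_val h) => ->;
    rewrite ?mulNmx ?mulmxN ?opprK; by [left|right].
have ce : cone (hat g *m (hat h *m tvec)).
  by apply: hat_cone; apply: hat_cone; exact: cone_tvec.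
rewrite -mulmxA lt_neqAle ce.1 andbT eq_sym; apply/eqP => t0.
have := causal_eq0 ce.2 t0 => /(congr1 (fun v => ldot v v)).
rewrite !hat_lorentz ldot_tvec tm_tvec -(scale0r tvec) ldotZl mul0r => /eqP.
by rewrite oppr_eq0 oner_eq0.
Qed.

Lemma hat1 : hat 1%g = 1%:M.
Proof. by apply: hat_eq; [left|rewrite mul1mx tm_tvec]. Qed.

Lemma hatK g v : hat g^-1%g *m (hat g *m v) = v.
Proof. by rewrite mulmxA -hatM mulVg hat1 mul1mx. Qed.

Lemma hatKV g v : hat g *m (hat g^-1%g *m v) = v.
Proof. by rewrite mulmxA -hatM mulgV hat1 mul1mx. Qed.

(** Transitivity of [SO(n,1)] on hyperbolic space. The point symmetry about the
    midpoint of [x] and the base point exchanges the two; if its determinant is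
    [-1], a reflection fixing the base point repairs it, and this is where a
    space direction is needed. *)
Lemma SO_transitive x : (0 < n)%N -> ldot x x = -1 -> 0 < tm x ->
  exists g : SO R n, hat g *m x = tvec.
Proof.
move=> n0 xx x0.
have [q qE] : {q | q = x + tvec} by exists (x + tvec).
have qq : ldot q q = - 2 - 2 * tm x by rewrite qE !ldotE xx; ring.
have qq0 : ldot q q != 0 by rewrite qq; apply/eqP; lra.
pose S : 'M[R]_n.+1 :=
  - 1%:M + (2 / ldot q q) *: (q *m (q^T *m lorentz_form R n)).
have SE v : S *m v = - v + (2 * ldot q v / ldot q q) *: q.
  rewrite mulmxDl mulNmx mul1mx -scalemxAl -mulmxA.
  rewrite [X in q *m X]mx11_scalar -ldot_mx mul_mx_scalar scalerA.
  by congr (_ + _ *: _); rewrite mulrAC.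
have LS : lorentz S.
  move=> v w; rewrite !SE !ldotE (ldotC v q); field.
  exact: qq0.
have Sx : S *m x = tvec.
  rewrite SE; have -> : 2 * ldot q x / ldot q q = 1.
    by rewrite qq qE !ldotE xx; field; apply/eqP; lra.
  by rewrite scale1r qE addKr.
have Se : S *m tvec = x.
  rewrite SE; have -> : 2 * ldot q tvec / ldot q q = 1.
    by rewrite qq qE !ldotE; field; apply/eqP; lra.
  by rewrite scale1r qE addrC addrK.
have [d1|d1] := lorentz_det LS.
  have Sm : SO_set S by split => //; exact/lorentzP.
  exists (SigSub (mem_set Sm)); rewrite (@hat_eq _ S)//=; first by left.
  by rewrite Se.
pose D : 'M[R]_n.+1 := diag_mx (\row_i (if i == 0 then -1 else 1)).
have n1 : (ord_max == 0 :> 'I_n.+1) = false by case: n n0.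
have De v : tm (D *m v) = tm v.
  by rewrite /tm mul_diag_mx !mxE n1 mul1r.
have LD : lorentz D.
  move=> v w; rewrite /ldot !De; congr (_ - _); apply: eq_bigr => i _.
  by rewrite !mul_diag_mx !mxE; case: ifP => _; ring.
have Dt : D *m tvec = tvec.
  apply/colP => i; rewrite mul_diag_mx !mxE.
  case: (eqVneq i ord_max) => [->|_]; last by rewrite mulr0.
  by rewrite n1 mulr1.
have dD : \det D = -1.
  rewrite det_diag (bigD1 0)//= mxE eqxx big1 ?mulr1// => i /negPf i0.
  by rewrite mxE i0.
have Sm : SO_set (D *m S).
  split; first by apply/lorentzP; exact: lorentz_mul.
  by rewrite det_mulmx dD d1 mulrNN mulr1.
exists (SigSub (mem_set Sm)); rewrite (@hat_eq _ (D *m S))//=.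
- by rewrite -mulmxA Sx Dt.
- by left.
- by rewrite -mulmxA De Se.
Qed.

End Isometries.
End Minkowski.

(** * Bounds on matrix entries *)

Section Bounded.
Context {R : realType} {n : nat}.
Implicit Types (g h : SO R n) (N : R) (v : 'cV[R]_n.+1).

Definition entries_le N g := forall i j, `|val g i j| <= N.

Lemma hat_norm g i j : `|hat g i j| = `|val g i j|.
Proof. by case: (hat_val g) => -> //; rewrite mxE normrN. Qed.

Lemma val_inv_norm g i j : `|val g^-1%g i j| = `|val g j i|.
Proof.
rewrite SO_inv_form mul_mx_diag mxE mul_diag_mx !mxE.
by case: eqP; case: eqP => _ _;
  rewrite ?mulN1r ?mulrN1 ?normrN ?mul1r ?mulr1 ?normrN.
Qed.

Lemma entries_leV N g : entries_le N g -> entries_le N g^-1%g.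
Proof. by move=> gN i j; rewrite val_inv_norm. Qed.

Lemma hat_enorm N g v : entries_le N g ->
  enorm (hat g *m v) <= (n.+1%:R * N) ^+ 2 * enorm v.
Proof.
move=> gN; have N0 : 0 <= N by apply: le_trans (normr_ge0 _) (gN 0 0).
have row i : (hat g *m v) i 0 ^+ 2 <= n.+1%:R * N ^+ 2 * enorm v.
  rewrite mxE; apply: le_trans (sum_CauchySchwarz _ _ _) _.
  rewrite -enormE ler_wpM2r ?enorm_ge0//.
  rewrite [leRHS](_ : _ = \sum_(j < n.+1) N ^+ 2); last first.
    by rewrite sumr_const card_ord mulr_natl.
  apply: ler_sum => j _; rewrite -real_normK ?num_real// hat_norm.
  by rewrite lerXn2r ?nnegrE.
rewrite enormE; apply: le_trans (ler_sum _ (fun i _ => row i)) _.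
have -> : (n.+1%:R * N) ^+ 2 * enorm v = n.+1%:R * (n.+1%:R * N ^+ 2 * enorm v).
  by ring.
by rewrite sumr_const card_ord [leRHS]mulr_natl.
Qed.

(** A Lorentz transformation is controlled by how far it moves the base point:
    its corner entry is the hyperbolic cosine of that distance. *)
Lemma entry_le_corner g i j :
  val g i j ^+ 2 <= 1 + tm (val g *m tvec) ^+ 2.
Proof.
have colE (h : SO R n) k : val h *m (delta_mx k 0 : 'cV_n.+1) = col k (val h).
  by rewrite colE.
have tvecE : tvec = delta_mx ord_max 0 :> 'cV[R]_n.+1.
  by apply/colP => k; rewrite !mxE eqxx andbT; case: eqP.
have corner (h : SO R n) : tm (val h *m tvec) = val h ord_max ord_max.
  by rewrite tvecE /tm colE mxE.
have Qcol (h : SO R n) k : val h k ord_max ^+ 2 <= tm (val h *m tvec) ^+ 2.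
  have [->|k0] := eqVneq k ord_max; first by rewrite corner.
  have : ldot (val h *m tvec) (val h *m tvec) <= 0.
    by rewrite SO_lorentz ldot_tvec tm_tvec lerN10.
  rewrite /ldot subr_le0 -expr2; apply: le_trans.
  rewrite /ip (bigD1 k)//= tvecE colE mxE expr2 lerDl sumr_ge0// => l _.
  by rewrite -expr2 sqr_ge0.
have row : val g ord_max j ^+ 2 <= tm (val g *m tvec) ^+ 2.
  rewrite -real_normK ?num_real// -[g]invgK val_inv_norm real_normK ?num_real//.
  apply: le_trans (Qcol _ _) _; rewrite !corner.
  rewrite -real_normK ?num_real// val_inv_norm real_normK ?num_real//.
  by rewrite invgK.
have [->|i0] := eqVneq i ord_max; first by apply: le_trans row _; rewrite lerDr.
have : ldot (col j (val g)) (col j (val g)) <= 1.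
  rewrite -colE SO_lorentz /ldot /ip.
  have [->|j0] := eqVneq j ord_max.
    rewrite big1 ?/tm ?mxE ?eqxx; last by move=> l /negPf l0;
      rewrite mxE l0 mul0r.
    by rewrite /= mulr1 sub0r (le_trans _ ler01)// lerN10.
  rewrite (bigD1 j)//= !mxE !eqxx big1 ?/tm ?mxE ?(eq_sym ord_max) ?(negPf j0)
    /=.
    by rewrite mulr1 mulr0 addr0 subr0.
  by move=> l /andP[_ /negPf lj]; rewrite mxE lj mul0r.
rewrite /ldot /ip (bigD1 i)//= => H.
have cE k : col j (val g) k 0 = val g k j by rewrite mxE.
move: H; rewrite {1 2}/tm !cE => H.
have : 0 <= \sum_(l | (l != ord_max) && (l != i)) col j (val g) l 0 * col j (val
  g) l 0.
  by apply: sumr_ge0 => l _; rewrite -expr2 sqr_ge0.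
move: row H; rewrite -!expr2; lra.
Qed.

End Bounded.

(** * Medians of real numbers *)

Section Median.
Context {R : realType}.
Implicit Types a b c m r : R.

Definition btw a m b := (a <= m <= b) || (b <= m <= a).

Definition med a b c := Num.max (Num.min a b) (Num.min (Num.max a b) c).

Lemma btwC a m b : btw a m b = btw b m a.
Proof. by rewrite /btw orbC. Qed.

Lemma medP a b c : exists2 m, m = med a b c &
  (a <= m <= b \/ b <= m <= a) /\ (b <= m <= c \/ c <= m <= b) /\
  (a <= m <= c \/ c <= m <= a).
Proof.
exists (med a b c) => //; rewrite /med; have [ab|ab] := leP a b.
  have [bc|bc] := leP b c; first by rewrite (max_r ab); lra.
  by rewrite /Num.max; case: ifPn; rewrite -?leNgt => ac; lra.
have [ac|ac] := leP a c; first by rewrite (max_r (ltW ab)); lra.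
by rewrite /Num.max; case: ifPn; rewrite -?leNgt => bc; lra.
Qed.

Lemma med_btw a b c :
  [/\ btw a (med a b c) b, btw b (med a b c) c & btw a (med a b c) c].
Proof.
have [m <- [h1 [h2 h3]]] := medP a b c.
by rewrite /btw; split; apply/orP.
Qed.

Lemma med_unique a b c m :
  btw a m b -> btw b m c -> btw a m c -> m = med a b c.
Proof.
have [m' <- [h1 [h2 h3]]] := medP a b c.
move=> /orP k1 /orP k2 /orP k3; apply/eqP; rewrite eq_le; lra.
Qed.

Lemma med_cases a b c : [\/ med a b c = a, med a b c = b | med a b c = c].
Proof.
rewrite /med /Num.max /Num.min.
by do !case: ifP => _; solve [exact: Or31|exact: Or32|exact: Or33].
Qed.

Lemma medD a b c r : med (a + r) (b + r) (c + r) = med a b c + r.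
Proof.
have [/orP h1 /orP h2 /orP h3] := med_btw a b c.
by apply/esym/med_unique; apply/orP; lra.
Qed.

Lemma btwM a m b r : btw a m b -> btw (r * a) (r * m) (r * b).
Proof.
rewrite /btw => /orP h; have [r0|r0] := leP 0 r.
  by apply/orP; case: h => /andP[h1 h2]; [left|right]; rewrite !ler_wpM2l.
by apply/orP; case: h => /andP[h1 h2]; [right|left]; rewrite !ler_wnM2l// ltW.
Qed.

Lemma medM a b c r : med (r * a) (r * b) (r * c) = r * med a b c.
Proof.
have [h1 h2 h3] := med_btw a b c.
by apply/esym/med_unique; exact: btwM.
Qed.

Lemma med_le a b c a' b' c' : a <= a' -> b <= b' -> c <= c' ->
  med a b c <= med a' b' c'.
Proof.
move=> ha hb hc.
have [/orP h1 /orP h2 /orP h3] := med_btw a b c.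
have [/orP k1 /orP k2 /orP k3] := med_btw a' b' c'.
lra.
Qed.

End Median.

(** * Time functions *)

Section TimeFunctions.
Context {R : realType} {n : nat}.
Implicit Types (u v w x y : 'cV[R]_n.+1) (s : 'cV[R]_n.+1 -> R) (a b r L : R).

(** A point [x] of hyperbolic space is determined by the walls through it, that
    is, by the spacelike hyperplane orthogonal to [x], the zero set of a linear
    function which can be normalised to grow at unit speed in time. Dropping
    linearity gives the generalised points of the median space: graphs over
    space whose slope is at most that of the light cone, encoded by the height
    above the graph. *)
Record time_function s : Prop := TimeFunction {
  tf_shift : forall v r, s (v + r *: tvec) = s v + r;
  tf_scale : forall r v, s (r *: v) = r * s v;
  tf_mono : forall v w, cone w -> s v <= s (v + w) }.

(** The zero set stays away from the light cone. Writing this as a comparison of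
    the Euclidean norm with the invariant form makes its behaviour under Lorentz
    transformations evident: only the left-hand side changes, by a factor that
    is controlled by the matrix entries. *)
Definition pinched L s := forall v, s v = 0 -> enorm v <= L * ldot v v.

Lemma tfN s v : time_function s -> s (- v) = - s v.
Proof. by move=> S; rewrite -scaleN1r (tf_scale S) mulN1r. Qed.

Lemma tf0 s : time_function s -> s 0 = 0.
Proof. by move=> S; rewrite -(scale0r 0) (tf_scale S) mul0r. Qed.

Lemma tf_graph s v : time_function s -> s (v + (- s v) *: tvec) = 0.
Proof. by move=> S; rewrite (tf_shift S) subrr. Qed.

Lemma tf_lip s v w r : time_function s -> 0 <= r ->
  enorm (v - w) <= r ^+ 2 -> `|s v - s w| <= 2 * r.
Proof.
move=> S r0; suff H x y : enorm (x - y) <= r ^+ 2 -> s y <= s x + 2 * r.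
  move=> vw; have h1 := H _ _ vw.
  have h2 : s v <= s w + 2 * r.
    by apply: H; rewrite -opprB -scaleN1r enormZ sqrrN expr1n mul1r.
  by rewrite ler_norml; lra.
rewrite /enorm addrC => xy.
have := tf_mono S y (cone_wait xy r0).
by rewrite addrA addrCA subrr addr0 (tf_shift S).
Qed.

Lemma tf_pinched s L v : 1 <= L -> time_function s -> pinched L s ->
  (L + 1) * (tm v - s v) ^+ 2 <= (L - 1) * ip v v.
Proof.
move=> L1 S P; have := P _ (tf_graph v S).
rewrite /enorm /ldot !ipDl !ipDr !ipZl !ipZr (ipC v) !ip_tvec !tmD !tmZ tm_tvec.
by lra.
Qed.

Lemma pinchedP s L : 1 <= L -> time_function s -> pinched L s <->
  forall v, (L + 1) * (tm v - s v) ^+ 2 <= (L - 1) * ip v v.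
Proof.
move=> L1 S; split=> [P v|P v v0]; first exact: tf_pinched.
have := P v; rewrite v0 /enorm /ldot; lra.
Qed.

Lemma pinched_le s L L' : 1 <= L -> L <= L' -> pinched L s -> pinched L' s.
Proof.
move=> L1 LL P v v0; apply: le_trans (P v v0) _; rewrite ler_wpM2r//.
have := P v v0; have := enorm_ge0 v; nra.
Qed.

(** The bound in [pinched] is convex in the time coordinate, hence holds between
    two zero sets as well. So two pinched zero sets enclose a region that is
    bounded in each slab [0 <= ldot v v <= r]. *)
Lemma pinched_between s s' L v : 1 <= L -> time_function s ->
  time_function s' -> pinched L s -> pinched L s' ->
  s v <= 0 -> 0 <= s' v -> enorm v <= L * ldot v v.
Proof.
move=> L1 S S' P P' v0 v0'.
have := tf_pinched v L1 S P; have := tf_pinched v L1 S' P'.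
rewrite /enorm /ldot; have [t0|t0] := leP 0 (tm v).
  have : tm v ^+ 2 <= (tm v - s v) ^+ 2 by nra.
  by move=> h1 h2 h3; nra.
have : tm v ^+ 2 <= (tm v - s' v) ^+ 2 by nra.
by move=> h1 h2 h3; nra.
Qed.

Lemma tf_med s1 s2 s3 : time_function s1 -> time_function s2 ->
  time_function s3 -> time_function (fun v => med (s1 v) (s2 v) (s3 v)).
Proof.
move=> S1 S2 S3; split=> [v r|r v|v w cw].
- by rewrite !tf_shift// medD.
- by rewrite !tf_scale// medM.
- by apply: med_le; exact: tf_mono.
Qed.

Lemma pinched_med s1 s2 s3 L : pinched L s1 -> pinched L s2 -> pinched L s3 ->
  pinched L (fun v => med (s1 v) (s2 v) (s3 v)).
Proof.
by move=> P1 P2 P3 v; case: (med_cases (s1 v) (s2 v) (s3 v)) => ->;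
  [exact: P1|exact: P2|exact: P3].
Qed.

Lemma tf_tm : time_function (tm : 'cV[R]_n.+1 -> R).
Proof.
split=> [v r|r v|v w [w0 _]]; first by rewrite tmD tmZ tm_tvec mulr1.
- exact: tmZ.
- by rewrite tmD lerDl.
Qed.

Lemma pinched_tm : pinched 1 (tm : 'cV[R]_n.+1 -> R).
Proof. by move=> v v0; rewrite enorm_ldot v0; lra. Qed.

(** Time functions increase strictly along timelike vectors, so no two points of
    a level set differ by one. *)
Lemma tf_achronal s v w : time_function s -> s v = s w ->
  0 <= ldot (v - w) (v - w).
Proof.
move=> S; wlog t0 : v w / 0 <= tm (v - w) => [H vw|vw].
  have [t0|t0] := leP 0 (tm (v - w)); first exact: H.
  have := H w v; rewrite -opprB tmN oppr_ge0 ltW// ldotNl ldotNr opprK.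
  by apply.
rewrite leNgt; apply/negP => Q0.
have t1 : 0 < tm (v - w).
  rewrite lt_neqAle t0 andbT eq_sym; apply/eqP => tz; move: Q0.
  rewrite /ldot tz mulr0 subr0; have := ip_ge0 (v - w); lra.
have [r r0 c] := cone_timelike Q0 t1.
have := tf_mono S (w + r *: tvec) c.
rewrite (tf_shift S) -vw.
have -> : w + r *: tvec + (v - w - r *: tvec) = v.
  by apply/colP => i; rewrite !mxE; ring.
lra.
Qed.

(** Two walls of a zero set are never separated by a positive distance:
    otherwise their sum or difference would be timelike. *)
Lemma tf_ldot_le s v w : time_function s -> s v = 0 -> s w = 0 ->
  ldot v v = 1 -> ldot w w = 1 -> `|ldot v w| <= 1.
Proof.
move=> S v0 w0 vv ww.
have := tf_achronal S (etrans v0 (esym w0)).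
have w0' : s (- w) = 0 by rewrite (tfN _ S) w0 oppr0.
have := tf_achronal S (etrans v0 (esym w0')).
by rewrite opprK !ldotE vv ww (ldotC w v) ler_norml; lra.
Qed.

(** An orthochronous Lorentz transformation [B] transports time functions: along
    each line in the time direction [s \o B] is strictly increasing with a
    unique zero, and the new time function is the height above that zero. *)
Lemma tf_transport B s : lorentz B -> 0 < tm (B *m tvec) -> time_function s ->
  exists2 s', time_function s' & forall v, Num.sg (s' v) = Num.sg (s (B *m v)).
Proof.
move=> LB B0 S; pose y := B *m tvec.
have yy : ldot y y < 0 by rewrite LB ldot_tvec tm_tvec; lra.
have [r0 r00 cy] := cone_timelike yy B0.
pose h v r := s (B *m v - r *: y).
have hd v r r' : r <= r' -> h v r' + (r' - r) * r0 <= h v r.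
  move=> rr; rewrite -subr_ge0 in rr.
  have := tf_mono S (B *m v - r' *: y + ((r' - r) * r0) *: tvec) (coneZ rr cy).
  rewrite (tf_shift S) => /le_trans; apply; rewrite le_eqVlt; apply/orP; left;
    apply/eqP; congr s.
  apply/colP => i; rewrite !mxE; ring.
have h_inj v r r' : h v r = h v r' -> r = r'.
  move=> e; have [lt|lt|//] := ltgtP r r'.
    have := hd v _ _ (ltW lt); rewrite e; nra.
  have := hd v _ _ (ltW lt); rewrite e; nra.
have h_root v : exists r, h v r = 0.
  pose a := `|h v 0| / r0.
  have a0 : 0 <= a by rewrite divr_ge0// ltW.
  have ar : a * r0 = `|h v 0| by rewrite mulfVK// gt_eqF.
  have h1 : h v a <= 0.
    have := hd v _ _ a0; rewrite subr0 ar; have := ler_norm (h v 0); lra.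
  have h2 : 0 <= h v (- a).
    have : - a <= 0 by rewrite oppr_le0.
    move=> /(hd v); rewrite sub0r opprK ar; have := ler_norm (- h v 0);
      rewrite normrN; lra.
  have cont : continuous (h v).
    pose C := enorm y + 1; have C0 : 0 < C by rewrite ltr_wpDl ?enorm_ge0.
    move=> r; apply/cvgrPdist_le => eps eps0; near=> r'.
    have : `|h v r - h v r'| <= 2 * (C * `|r - r'|).
      apply: tf_lip => //; first by rewrite mulr_ge0// ltW.
      have -> : B *m v - r *: y - (B *m v - r' *: y) = (r' - r) *: y.
        by apply/colP => i; rewrite !mxE; ring.
      rewrite enormZ exprMn real_normK ?num_real// mulrC -sqrrN opprB.
      rewrite ler_wpM2r ?sqr_ge0// /C; have := enorm_ge0 y; nra.
    move=> /le_trans; apply.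
    rewrite mulrA -ler_pdivlMl ?mulr_gt0//; near: r'.
    have e0 : 0 < (2 * C)^-1 * eps by rewrite mulr_gt0// invr_gt0 mulr_gt0.
    by apply: (cvgrPdist_le _ _).1 e0; exact: cvg_id.
  have aa : - a <= a by lra.
  have [|c _ hc] := @IVT R (h v) (- a) a 0 aa (continuous_subspaceT cont).
    by rewrite ge_min h1 orbT le_max h2.
  by exists c.
have [s' s'h] := choice h_root.
exists s'; first split=> [v r|r v|v w cw].
- apply/eqP; rewrite -subr_eq; apply/eqP/(h_inj v);
  rewrite s'h -[RHS](s'h (v + r *: tvec)).
  by rewrite /h mulmxDr -scalemxAr -/y; congr s; apply/colP => i; rewrite !mxE;
    ring.
- apply: (h_inj (r *: v)); rewrite s'h; have := congr1 ( *%R r) (s'h v).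
  rewrite mulr0 => <-; rewrite /h -(tf_scale S) -scalemxAr; congr s.
  by apply/colP => i; rewrite !mxE; ring.
- rewrite leNgt; apply/negP => lt.
  have : h v (s' v) <= h (v + w) (s' v).
    have := tf_mono S (B *m v - s' v *: y) (orthochronous_cone LB B0 cw).
    by move=> /le_trans; apply; rewrite /h mulmxDr addrAC.
  have := hd (v + w) _ _ (ltW lt); rewrite !s'h; nra.
move=> v; have -> : s (B *m v) = h v 0 by rewrite /h scale0r subr0.
have [lt|gt|e] := ltgtP (s' v) 0; last by rewrite -{1}e s'h e.
  have := hd v _ _ (ltW lt); rewrite s'h => H.
  by rewrite !ltr0_sg//; nra.
have := hd v _ _ (ltW gt); rewrite s'h => H.
by rewrite !gtr0_sg//; nra.
Unshelve. all: by end_near. Qed.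

(** A time function is the height above its zero set. *)
Lemma tf_sg_inj s s' : time_function s -> time_function s' ->
  (forall v, Num.sg (s v) = Num.sg (s' v)) -> s = s'.
Proof.
move=> S S' e; apply/funext => v.
have := e (v + (- s v) *: tvec); rewrite (tf_graph v S) sgr0 => /esym/eqP.
by rewrite sgr_eq0 (tf_shift S') subr_eq0 => /eqP.
Qed.

(** The Helly-type statement behind cocompactness. Take a wall [v1] of the zero
    set that is nearly as far from the base point as possible, and let [x] be
    the projection of the base point to it. By [tf_ldot_le] every other wall
    meets [v1] or is asymptotic to it, and as it is not much farther from the
    base point than [v1], it passes within bounded distance of [x]. *)
Lemma tf_center s L : (0 < n)%N -> 1 <= L -> time_function s -> pinched L s ->
  exists x, [/\ ldot x x = -1, 0 < tm x &
    forall v, s v = 0 -> ldot v v = 1 -> ldot x v ^+ 2 <= 9].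
Proof.
move=> n0 L1 S P.
pose A := [set r | exists v, [/\ s v = 0, ldot v v = 1 & r = tm v]].
have Aub v : s v = 0 -> ldot v v = 1 -> tm v <= L.
  move=> v0 vv; have := P v v0; rewrite vv enorm_ldot vv; nra.
have AN v : s v = 0 -> ldot v v = 1 -> s (- v) = 0 /\ ldot (- v) (- v) = 1.
  by move=> v0 vv; rewrite (tfN _ S) v0 oppr0 ldotNl ldotNr opprK.
have [H|/existsNP[r /not_implyP[[v0 [s0 q0 ->]] /negP]]] :=
    pselect (forall r, A r -> r <= 1).
  exists tvec; rewrite ldot_tvec tm_tvec; split=> // v v0 vv.
  rewrite ldot_tvec; have h1 : tm v <= 1 by apply: H; exists v.
  have [v0' vv'] := AN _ v0 vv.
  have h2 : tm (- v) <= 1 by apply: H; exists (- v).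
  by move: h2; rewrite tmN; nra.
rewrite -ltNge => t0.
have supA : has_sup A.
  split; first by exists (tm v0), v0.
  by exists L => _ [v [v0' vv ->]]; exact: Aub.
have sup0 : 1 < sup A by apply: lt_le_trans t0 _; apply: ub_le_sup;
  [exact: supA.2|exists v0].
have sup2 : 0 < sup A / 2 by lra.
have [_ [v1 [s1 q1 ->]] lt1] := sup_adherent sup2 supA.
set T := tm v1 in lt1.
have T0 : 0 < T by lra.
have bnd v : s v = 0 -> ldot v v = 1 -> tm v <= 2 * T.
  move=> v0' vv; have : tm v <= sup A by apply: ub_le_sup;
    [exact: supA.2|exists v].
  lra.
have D0 : 0 < 1 + T ^+ 2 by nra.
pose D := Num.sqrt (1 + T ^+ 2);
  have DD : D ^+ 2 = 1 + T ^+ 2 by rewrite sqr_sqrtr// ltW.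
have Dp : 0 < D by rewrite sqrtr_gt0.
(* The projection of the base point to the wall [v1], normalised. *)
exists (D^-1 *: (tvec + T *: v1)); split.
- rewrite !ldotE (_ : ldot v1 v1 = 1)// -/T.
  transitivity (- (D^-1 ^+ 2 * (1 + T ^+ 2))); first by ring.
  by rewrite -DD exprVn mulVf// expf_neq0// gt_eqF.
- by rewrite !ldotE mulr_gt0 ?invr_gt0//; rewrite -/T; nra.
- move=> v v0' vv; rewrite !ldotE exprMn exprVn.
  rewrite ler_pdivrMl ?exprn_gt0// DD.
  have := bnd v v0' vv; have [v0n vvn] := AN _ v0' vv; have := bnd _ v0n vvn.
  rewrite tmN; have := tf_ldot_le S s1 v0' q1 vv; rewrite ler_norml => /andP[].
  set c := ldot v1 v; set t := tm v => h1 h2 h3 h4.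
  have k1 : - (3 * T) <= - t + T * c by nra.
  have k2 : - t + T * c <= 3 * T by nra.
  nra.
Qed.

End TimeFunctions.

(** * The action of the Lorentz group on time functions *)

Section Action.
Context {R : realType} {n : nat}.
Implicit Types (g h : SO R n) (u v w : 'cV[R]_n.+1) (s : 'cV[R]_n.+1 -> R).
Implicit Types (N L : R).

(** The zero set of [tf_act g s] is the image under [hat g] of that of [s]; as
    [s] is the height above a graph, the function [s] itself is not simply
    composed with the inverse. *)
Definition tf_act g s : 'cV[R]_n.+1 -> R :=
  xget s [set s' | time_function s' /\
    forall v, Num.sg (s' v) = Num.sg (s (hat g^-1%g *m v))].

Lemma tf_actP g s : time_function s -> time_function (tf_act g s) /\
  forall v, Num.sg (tf_act g s v) = Num.sg (s (hat g^-1%g *m v)).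
Proof.
move=> S; have [s' S' e] := tf_transport (hat_lorentz g^-1%g) (hat_tvec_gt0 _)
  S.
rewrite /tf_act; case: xgetP => [s'' _ //|/(_ s') []]; by split.
Qed.

Lemma tf_act_time_function g s : time_function s -> time_function (tf_act g s).
Proof. by move=> /(tf_actP g) []. Qed.

Lemma tf_act_sg g s v : time_function s ->
  Num.sg (tf_act g s v) = Num.sg (s (hat g^-1%g *m v)).
Proof. by move=> /(tf_actP g) []. Qed.

Lemma tf_act_eq0 g s v : time_function s ->
  tf_act g s v = 0 <-> s (hat g^-1%g *m v) = 0.
Proof.
move=> S; have e := tf_act_sg g v S.
by split=> z; apply/eqP; rewrite -sgr_eq0; [rewrite -e|rewrite e];
  rewrite z sgr0.
Qed.

Lemma tf_act_gt0 g s v : time_function s ->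
  (0 < tf_act g s v) = (0 < s (hat g^-1%g *m v)).
Proof. by move=> S; rewrite -sgr_gt0 tf_act_sg// sgr_gt0. Qed.

Lemma tf_act1 s : time_function s -> tf_act 1%g s = s.
Proof.
move=> S; apply: tf_sg_inj => // [|v]; first exact: tf_act_time_function.
by rewrite tf_act_sg// invg1 hat1 mul1mx.
Qed.

Lemma tf_actM g h s : time_function s ->
  tf_act (g * h)%g s = tf_act g (tf_act h s).
Proof.
move=> S; have Sh := tf_act_time_function h S.
apply: tf_sg_inj => // [||v]; try exact: tf_act_time_function.
by rewrite !tf_act_sg// invgM hatM mulmxA.
Qed.

Lemma tf_act_pinched N g s L : entries_le N g -> 0 <= L -> time_function s ->
  pinched L s -> pinched ((n.+1%:R * N) ^+ 2 * L) (tf_act g s).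
Proof.
move=> gN L0 S P v /(tf_act_eq0 _ _ S) v0.
rewrite -{1}[v](hatKV g); apply: le_trans (hat_enorm _ gN) _.
rewrite -mulrA ler_wpM2l ?sqr_ge0//.
by apply: le_trans (P _ v0) _; rewrite hat_lorentz.
Qed.

(** The group moves the centre provided by [tf_center] to the base point; the
    constant is [1 + 2 * 9], with [9] from [tf_center]. *)
Lemma tf_act_center s L : (0 < n)%N -> 1 <= L -> time_function s ->
  pinched L s -> exists g, pinched 19 (tf_act g s).
Proof.
move=> n0 L1 S P; have [x [xx x0 H]] := tf_center n0 L1 S P.
have [g gx] := SO_transitive n0 xx x0; exists g => v /(tf_act_eq0 _ _ S).
set w := _ *m v => w0.
have ww : ldot w w = ldot v v by rewrite hat_lorentz.
have tw : tm v = - ldot x w.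
  by rewrite -(hat_lorentz g x w) gx hatKV ldot_tvec opprK.
have q0 : 0 <= ldot w w by have := P w w0; have := enorm_ge0 w; nra.
suff : ldot x w ^+ 2 <= 9 * ldot w w by rewrite enorm_ldot tw -ww; lra.
move: q0; rewrite le_eqVlt => /orP[/eqP q0|q0].
  have : w = 0 by apply: enorm_eq0; have := P w w0; rewrite -q0; lra.
  by move=> ->; rewrite -(scale0r w) !ldotZr !mul0r expr0n mulr0.
pose a := (Num.sqrt (ldot w w))^-1.
have a2 : a ^+ 2 = (ldot w w)^-1 by rewrite exprVn sqr_sqrtr// ltW.
have := H (a *: w); rewrite (tf_scale S) w0 mulr0 => /(_ erefl).
rewrite !ldotZl !ldotZr mulrA -expr2 a2 mulVf ?gt_eqF// => /(_ erefl).
by rewrite exprMn a2 ler_pdivrMl// mulrC.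
Qed.

(** Properness. Let [y] be the preimage of the time vector and [z] the point of
    the zero set below or above it. The time coordinate of the image of [z] is
    the pairing of [y] with [z] up to sign; as the image lies in a pinched zero
    set too, this pairing is bounded by the length of [z], and since [y] is a
    unit timelike vector that bounds [z], then [y], then [g]. *)
Lemma tf_act_proper s L g : 1 <= L -> time_function s -> pinched L s ->
  pinched L (tf_act g s) -> entries_le (4 * (1 + 2 * L)) g.
Proof.
move=> L1 S P Pg; pose y := hat g^-1%g *m tvec.
pose z := y + (- s y) *: tvec; have z0 : s z = 0 by exact: tf_graph.
pose q := ldot z z; have Ez : enorm z <= L * q by exact: P.
have : tf_act g s (hat g *m z) = 0 by apply/tf_act_eq0 => //; rewrite hatK.
move=> /Pg; rewrite hat_lorentz -/q => Ew.
have tw : tm (hat g *m z) = - ldot y z.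
  by rewrite -(hat_lorentz g y z) hatKV ldot_tvec opprK.
have b2 : ldot y z ^+ 2 <= L * q.
  apply: le_trans Ew; rewrite /enorm tw sqrrN; have := ip_ge0 (hat g *m z); lra.
have yy : ldot y y = -1 by rewrite hat_lorentz ldot_tvec tm_tvec.
have yE : y = z + s y *: tvec by rewrite /z -addrA -scalerDl addNr scale0r
  addr0.
have q1 : q = ldot y y + 2 * s y * tm y - s y ^+ 2.
  by rewrite /q /z !ldotE; ring.
have tz : tm y = tm z + s y by rewrite {1}yE !ldotE; ring.
have yz : ldot y z = ldot y y + s y * tm y by rewrite /z !ldotE; ring.
have zt : tm z ^+ 2 <= L * q by apply: le_trans Ez; rewrite /enorm;
  have := ip_ge0 z; lra.
have ty : tm y ^+ 2 <= 2 * (1 + 2 * L) ^+ 2.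
  move: q1 yz b2; rewrite yy => q1 yz b2.
  have b : ldot y z = (q - 1 + s y ^+ 2) / 2 by rewrite yz q1; field.
  have q0 : 0 <= q by have := enorm_ge0 z; nra.
  have k : s y ^+ 2 + q / 2 <= 1 + 2 * L.
    set c := ldot y z in b b2.
    have c1 : 2 * c <= q / 2 + 2 * L.
      rewrite leNgt; apply/negP => lt.
      have A0 : 0 <= q / 2 + 2 * L by lra.
      have : (q / 2 + 2 * L) ^+ 2 < (2 * c) ^+ 2.
        by rewrite ltr_pXn2r ?nnegrE// ltW// (le_lt_trans A0).
      have := sqr_ge0 (q / 2 - 2 * L); lra.
    by move: c1; rewrite b; lra.
  rewrite tz; nra.
move=> i j; rewrite -[g]invgK val_inv_norm.
rewrite -(ler_pXn2r (ltn0Sn 1)) ?nnegrE//; last lra.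
rewrite real_normK ?num_real//; apply: le_trans (entry_le_corner _ _ _) _.
have -> : tm (val g^-1%g *m tvec) ^+ 2 = tm y ^+ 2.
  by rewrite /y; case: (hat_val g^-1%g) => ->; rewrite ?mulNmx ?tmN ?sqrrN.
by nra.
Qed.

Lemma entries_le_exists g : exists N, entries_le N g.
Proof.
exists (\sum_i \sum_j `|val g i j|) => i j.
rewrite (bigD1 i)//= (bigD1 j)//= -addrA lerDl addr_ge0//.
  by apply: sumr_ge0.
by apply: sumr_ge0 => k _; apply: sumr_ge0.
Qed.

End Action.

(** * Unimodular matrices as approximate lattice permutations *)

Section LatticeApproximation.
Context {R : realType}.

Definition zvec m (k : 'cV[int]_m) : 'cV[R]_m := map_mx intr k.

(** A linear map is almost a permutation of the lattice when some bijection of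
    [Z^m] stays at bounded distance from it. Such maps preserve the asymptotic
    number of lattice points of a set, hence play the part of volume preserving
    maps. *)
Definition almost_permutation m (A : 'M[R]_m) :=
  exists (C : R) (phi : 'cV[int]_m -> 'cV[int]_m),
  bijective phi /\ forall k i, `|(A *m zvec k) i 0 - (phi k i 0)%:~R| <= C.

Lemma almost_permutation1 m : almost_permutation (1%:M : 'M[R]_m).
Proof.
exists 0, id; split; first by exists id.
by move=> k i; rewrite mul1mx mxE subrr normr0.
Qed.

Lemma almost_permutationM m (A B : 'M[R]_m) :
  almost_permutation A -> almost_permutation B -> almost_permutation (A *m B).
Proof.
move=> [C [phi [bphi HA]]] [D [psi [bpsi HB]]].
exists (C + \sum_i \sum_j `|A i j| * D), (phi \o psi).
split; first exact: bij_comp.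
move=> k i; have D0 : 0 <= D by apply: le_trans (normr_ge0 _) (HB k i).
rewrite -mulmxA; set v := B *m _.
have -> : (A *m v) i 0 - (phi (psi k) i 0)%:~R =
  ((A *m zvec (psi k)) i 0 - (phi (psi k) i 0)%:~R) + (A *m (v - zvec (psi k)))
    i 0.
  by rewrite mulmxBr !mxE; ring.
apply: le_trans (ler_normD _ _) (lerD (HA _ _) _).
rewrite mxE; apply: le_trans (ler_norm_sum _ _ _) _.
rewrite [leRHS](bigD1 i)//= -[leLHS]addr0 lerD//; last first.
  by apply: sumr_ge0 => a _; apply: sumr_ge0 => b _; rewrite mulr_ge0.
apply: ler_sum => j _; rewrite normrM ler_wpM2l//.
by have := HB k j; rewrite !mxE.
Qed.

Lemma floor_dist (x : R) : `|x - (Num.floor x)%:~R| <= 1.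
Proof.
have /andP[h1 h2] := floor_itv x.
by rewrite ler_norml; move: h2; rewrite intrD; lra.
Qed.

Lemma almost_permutation_upper m (b : 'rV[R]_m) (D : 'M[R]_m) :
  almost_permutation D -> almost_permutation (block_mx (1%:M : 'M[R]_1) b 0 D).
Proof.
move=> [C [phi [[psi phiK psiK] H]]].
pose f (y : 'cV[int]_m) : 'cV[int]_1 :=
  const_mx (Num.floor ((b *m zvec y) 0 0)).
exists (Num.max C 1), (fun k : 'cV_(1 + m) =>
  col_mx (usubmx k + f (dsubmx k)) (phi (dsubmx k))).
split.
  exists (fun k : 'cV_(1 + m) => col_mx (usubmx k - f (psi (dsubmx k))) (psi
    (dsubmx k))) => k.
    by rewrite col_mxKu col_mxKd phiK addrK vsubmxK.
  by rewrite col_mxKu col_mxKd psiK subrK vsubmxK.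
move=> k i; rewrite -{1}[k]vsubmxK /zvec map_col_mx mul_block_col -!/(zvec _).
rewrite mul1mx mul0mx add0r.
case: (split_ordP i) => j ->; rewrite le_max.
  apply/orP; right; rewrite !col_mxEu !ord1 [X in X - _]mxE [in X in _ - X]mxE.
  rewrite [in X in _ + X - _]mxE -/(f _) [f _ _ _]mxE intrD [zvec _ _ _]mxE.
  rewrite opprD addrACA subrr add0r.
  by have := floor_dist ((b *m zvec (dsubmx k)) 0 0); rewrite [X in X - _]mxE.
by apply/orP; left; rewrite !col_mxEd; exact: H.
Qed.

Lemma almost_permutation_lower m (c : 'cV[R]_m) :
  almost_permutation (block_mx (1%:M : 'M[R]_1) 0 c 1%:M).
Proof.
pose f (x : 'cV[int]_1) : 'cV[int]_m := map_mx Num.floor (c *m zvec x).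
exists 1, (fun k : 'cV_(1 + m) => col_mx (usubmx k) (dsubmx k + f (usubmx k))).
split.
  exists (fun k : 'cV_(1 + m) => col_mx (usubmx k) (dsubmx k - f (usubmx k))) =>
    k.
    by rewrite col_mxKu col_mxKd addrK vsubmxK.
  by rewrite col_mxKu col_mxKd subrK vsubmxK.
move=> k i; rewrite -{1}[k]vsubmxK /zvec map_col_mx mul_block_col -!/(zvec _).
rewrite !mul1mx mul0mx addr0.
case: (split_ordP i) => j ->; rewrite ?col_mxEu ?col_mxEd.
  by rewrite [X in X - _]mxE subrr normr0 ler01.
rewrite [X in X - _]mxE [in X in _ - X]mxE [f _ _ _]mxE intrD [zvec (dsubmx k) _
  _]mxE.
by rewrite opprD addrA addrK floor_dist.
Qed.

(** Gaussian elimination writes a matrix of determinant [1] as a product of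
    shears, and a shear becomes a bijection of the lattice when the coordinate
    that it changes is rounded down. *)
Lemma det1_almost_permutation m (A : 'M[R]_m) :
  \det A = 1 -> almost_permutation A.
Proof.
elim: m A => [|m IH] A dA.
  by have -> : A = 1%:M; [apply/matrixP => -[]|exact: almost_permutation1].
(* A corner entry [1] allows to clear its row and its column. *)
have corner1 (B : 'M[R]_(1 + m)) :
    \det B = 1 -> ulsubmx B = 1%:M -> almost_permutation B.
  move=> dB ul; rewrite -[B]submxK ul.
  have E : block_mx 1%:M (ursubmx B) (dlsubmx B) (drsubmx B) =
    block_mx (1%:M : 'M[R]_1) 0 (dlsubmx B) 1%:M *m
    block_mx 1%:M (ursubmx B) 0 (drsubmx B - dlsubmx B *m ursubmx B).
    by rewrite mulmx_block !(mul1mx, mulmx1, mul0mx, mulmx0, addr0,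
      add0r) addrC subrK.
  rewrite E; apply: almost_permutationM; first exact: almost_permutation_lower.
  apply/almost_permutation_upper/IH; rewrite -dB -[in RHS](submxK B) ul E.
  by rewrite det_mulmx det_lblock det_ublock !det1 !mul1r.
have shear_down (B : 'M[R]_(1 + m)) (c : 'cV[R]_m) :
    almost_permutation (block_mx (1%:M : 'M[R]_1) 0 c 1%:M *m B) ->
      almost_permutation B.
  move=> /(almost_permutationM (almost_permutation_lower (- c))).
  by rewrite mulmxA mulmx_block !(mul1mx, mulmx1, mul0mx, mulmx0, addr0,
    add0r) addNr -scalar_mx_block mul1mx.
have shear_up (B : 'M[R]_(1 + m)) (b : 'rV[R]_m) :
    almost_permutation (block_mx (1%:M : 'M[R]_1) b 0 1%:M *m B) ->
      almost_permutation B.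
  move=> /(almost_permutationM (almost_permutation_upper (- b)
    (almost_permutation1 m))).
  by rewrite mulmxA mulmx_block !(mul1mx, mulmx1, mul0mx, mulmx0, addr0,
    add0r) addrN -scalar_mx_block mul1mx.
have pivot (B : 'M[R]_(1 + m)) j : \det B = 1 -> dlsubmx B j 0 != 0 ->
    almost_permutation B.
  move=> dB cj.
  apply: (shear_up _ (((1 - ulsubmx B 0 0) / dlsubmx B j 0) *: delta_mx 0 j)).
  apply: corner1; first by rewrite det_mulmx det_ublock !det1 !mul1r.
  rewrite -{3}[B]submxK mulmx_block block_mxKul mul1mx -scalemxAl -rowE.
  apply/matrixP => a b; rewrite !ord1 !mxE.
  by move: cj; rewrite !mxE => cj; rewrite divfK// addrC subrK.
have [/existsP[j cj]|] := boolP [exists j,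
  dlsubmx (A : 'M[R]_(1 + m)) j 0 != 0].
  exact: pivot cj.
rewrite negb_exists => /forallP c0.
have dl0 : dlsubmx (A : 'M[R]_(1 + m)) = 0.
  by apply/matrixP => a b; rewrite ord1 [RHS]mxE; apply/eqP; have := c0 a;
    rewrite negbK.
case: m IH A dA corner1 shear_down shear_up pivot c0 dl0 =>
  [|m] IH A dA corner1 shear_down _ pivot _ dl0.
  apply: corner1 => //; move: dA; rewrite -[A](@submxK _ 1 0 1 0) dl0.
  rewrite (det_ublock (ulsubmx (A : 'M[R]_(1 + 0))) _ (drsubmx (A :
    'M[R]_(1 + 0)))).
  rewrite (det_mx00 (drsubmx _)) mulr1 det_mx11 => e.
  by rewrite block_mxKul [LHS]mx11_scalar e.
(* The first column is zero below the corner: create a pivot there. *)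
apply: (shear_down A (delta_mx 0 0)).
have dl1 : dlsubmx (block_mx (1%:M : 'M[R]_1) 0 (delta_mx 0 0) 1%:M *m (A :
  'M[R]_(1 + m.+1))) 0 0 =
    ulsubmx (A : 'M[R]_(1 + m.+1)) 0 0.
  rewrite -{1}[A](@submxK _ 1 m.+1 1 m.+1) dl0 mulmx_block block_mxKdl.
  by rewrite mulmx0 addr0 mxE big_ord1 mxE !eqxx mul1r.
apply: (pivot _ 0); first by rewrite det_mulmx det_lblock !det1 !mul1r.
rewrite dl1; apply/eqP => ul0; move: dA.
rewrite -[A](@submxK _ 1 m.+1 1 m.+1) dl0.
rewrite (det_ublock (ulsubmx (A : 'M[R]_(1 + m.+1))) _ (drsubmx (A :
  'M[R]_(1 + m.+1)))).
rewrite det_mx11 ul0 mul0r => /eqP.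
by rewrite eq_sym oner_eq0.
Qed.

Lemma almost_permutationN m (A : 'M[R]_m) :
  almost_permutation A -> almost_permutation (- A).
Proof.
move=> [C [phi [bphi H]]]; exists C, (fun k => - phi k); split.
  by apply: (bij_comp _ bphi); exists -%R => k; rewrite opprK.
move=> k i; rewrite mulNmx mxE [(- phi k) i 0]mxE intrN -opprD normrN.
exact: H.
Qed.

End LatticeApproximation.

(** * Limits along an ultrafilter *)

Section UltraLimit.
Context {R : realType}.
Implicit Types (u v : nat -> R) (c : R).

Lemma ultra_bounded_cvg T (F : set_system T) (f : T -> R) (C : R) :
  UltraFilter F -> (\forall x \near F, `|f x| <= C) ->
  exists l : R, f x @[x --> F] --> l.
Proof.
move=> UF fC; have PF := ultra_proper.
have [|l [_ cl]] := @segment_compact R (- C) C (f x @[x --> F]) _.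
  by apply: filterS fC => x /=; rewrite in_itv /= -ler_norml.
exists l => A Al; have [//|nA] := in_ultra_setVsetC (f @^-1` A) UF.
by have [x [nx Ax]] := cl (~` A) A nA Al.
Qed.

Definition ultra_nat : set_system nat :=
  sval (cid (ultraFilterLemma (eventually_filter))).

#[local] Instance ultra_natP : UltraFilter ultra_nat.
Proof. by rewrite /ultra_nat; case: cid => F []. Qed.

#[local] Instance ultra_nat_proper : ProperFilter ultra_nat.
Proof. exact: ultra_proper. Qed.

Lemma ultra_nat_near (P : set nat) : (\forall N \near \oo, P N) -> ultra_nat P.
Proof. by rewrite /ultra_nat; case: cid => F [_ /= +] h; exact. Qed.

Definition ulim u : R := lim (u N @[N --> ultra_nat]).

Definition bounded_seq u := exists C, \forall N \near \oo, `|u N| <= C.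

Lemma ulim_cvg u : bounded_seq u -> u N @[N --> ultra_nat] --> ulim u.
Proof.
move=> [C uC].
have [l ul] := ultra_bounded_cvg ultra_natP (ultra_nat_near uC).
by rewrite /ulim (cvg_lim _ ul).
Qed.

Lemma bounded_seqD u v : bounded_seq u -> bounded_seq v ->
  bounded_seq (fun N => u N + v N).
Proof.
move=> [C uC] [D vD]; exists (C + D); near=> N.
apply: le_trans (ler_normD _ _) (lerD _ _); by near: N.
Unshelve. all: by end_near. Qed.

Lemma ulimD u v : bounded_seq u -> bounded_seq v ->
  ulim (fun N => u N + v N) = ulim u + ulim v.
Proof.
move=> bu bv; apply: cvg_lim => //.
exact: cvgD (ulim_cvg bu) (ulim_cvg bv).
Qed.

Lemma ulim_le u v : bounded_seq u -> bounded_seq v ->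
  (\forall N \near \oo, u N <= v N) -> ulim u <= ulim v.
Proof.
move=> bu bv uv; apply: ler_cvg_to (ulim_cvg bu) (ulim_cvg bv) _.
exact: ultra_nat_near.
Qed.

Lemma ulim_cst c : ulim (fun=> c) = c.
Proof. by apply: cvg_lim => //; exact: cvg_cst. Qed.

Lemma bounded_cst c : bounded_seq (fun=> c).
Proof. by exists `|c|; exact: nearW. Qed.

Lemma ulim_le_cst u c : bounded_seq u ->
  (\forall N \near \oo, u N <= c) -> ulim u <= c.
Proof. by move=> bu uc; rewrite -[leRHS]ulim_cst; apply: ulim_le => //;
  exact: bounded_cst. Qed.

Lemma ulim_ge_cst u c : bounded_seq u ->
  (\forall N \near \oo, c <= u N) -> c <= ulim u.
Proof. by move=> bu uc; rewrite -[leLHS]ulim_cst; apply: ulim_le => //;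
  exact: bounded_cst. Qed.

Lemma near_inv_lt (C eps : R) : 0 < eps -> \forall N \near \oo, C / N%:R < eps.
Proof.
move=> e0; near=> N.
have N0 : 0 < N%:R :> R by rewrite ltr0n; near: N; exact: nbhs_infty_gt.
rewrite ltr_pdivrMr// mulrC -ltr_pdivrMr//.
apply: le_lt_trans (ler_norm _) _.
apply: lt_trans (archi_boundP (normr_ge0 _)) _.
by rewrite ltr_nat; near: N; exact: nbhs_infty_gt.
Unshelve. all: by end_near. Qed.

Lemma ulim_eq u v C : bounded_seq u -> bounded_seq v ->
  (\forall N \near \oo, `|u N - v N| <= C / N%:R) -> ulim u = ulim v.
Proof.
move=> bu bv uv; apply: cvg_lim => //.
have -> : u = (fun N => v N + (u N - v N)) by apply/funext => N;
  rewrite addrC subrK.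
rewrite -[X in _ --> X]addr0; apply: cvgD; first exact: ulim_cvg.
apply/cvgrPdist_le => eps e0; apply: ultra_nat_near.
near=> N; rewrite sub0r normrN; apply: (@le_trans _ _ (C / N%:R));
  first by near: N.
by apply: ltW; near: N; exact: near_inv_lt.
Unshelve. all: by end_near. Qed.

End UltraLimit.

(** * Sums over the integer lattice *)

Section LatticeSums.
Context {R : realType} {m : nat}.
Implicit Types (F G : 'cV[int]_m -> R) (k l : 'cV[int]_m).

Definition lattice_sum F : R := \sum_(k \in [set: 'cV[int]_m]) F k.
Definition finitely_supported F := finite_set [set k | F k != 0].
Definition box (B : 'I_m -> nat) := [set k : 'cV[int]_m | forall i,
  (`|k i 0%R| <= B i)%N].

Lemma lattice_sum_seq F D : finite_set D -> (forall k, F k != 0 -> D k) ->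
  lattice_sum F = \sum_(k <- fset_set D) F k.
Proof.
move=> fD FD; rewrite /lattice_sum fsbig_supp setTI.
apply: fsbig_fwiden.
- by move=> k /= /eqP /FD Dk; rewrite /= in_fset_set// inE.
- exact: fset_uniq.
- by move=> k [_ h]; apply: contrapT h.
Qed.

Lemma finitely_supported_le F G : (forall k,
  F k != 0 -> G k != 0) -> finitely_supported G -> finitely_supported F.
Proof. by move=> FG; apply: sub_finite_set => k /=; exact: FG. Qed.

Lemma finitely_supportedD F G : finitely_supported F -> finitely_supported G ->
  finitely_supported (fun k => F k + G k).
Proof.
move=> fF fG; apply: sub_finite_set (_ :
  finite_set ([set k | F k != 0] `|` [set k | G k != 0])).
  move=> k /=; have [->|] := eqVneq (F k) 0; last by left.
  by rewrite add0r; right.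
by rewrite finite_setU.
Qed.

Lemma lattice_sumD F G : finitely_supported F -> finitely_supported G ->
  lattice_sum (fun k => F k + G k) = lattice_sum F + lattice_sum G.
Proof.
move=> fF fG.
pose D := [set k | F k != 0] `|` [set k | G k != 0].
have fD : finite_set D by rewrite finite_setU.
rewrite !(@lattice_sum_seq _ D)// ?big_split// => k; rewrite /D /=.
- by right.
- by left.
- have [->|] := eqVneq (F k) 0; last by left.
  by rewrite add0r; right.
Qed.

Lemma lattice_sum_le F G : finitely_supported F -> finitely_supported G ->
  (forall k, F k <= G k) -> lattice_sum F <= lattice_sum G.
Proof.
move=> fF fG FG.
pose D := [set k | F k != 0] `|` [set k | G k != 0].
have fD : finite_set D by rewrite finite_setU.
rewrite !(@lattice_sum_seq _ D)//; first exact: ler_sum.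
  by move=> k; right.
by move=> k; left.
Qed.

Lemma lattice_sumN F : lattice_sum (fun k => - F k) = - lattice_sum F.
Proof.
have [fin|inf] := pselect (finitely_supported F).
  rewrite !(@lattice_sum_seq _ [set k | F k != 0])// ?sumrN// => k.
  by rewrite oppr_eq0.
have E (G : 'cV[int]_m -> R) : ~ finitely_supported G -> lattice_sum G = 0.
  move=> nG; rewrite /lattice_sum no_finite_support ?big_nil// setTI => h.
  by apply: nG; apply: sub_finite_set h => k /= /eqP.
rewrite !E ?oppr0// => h; apply: inf; apply: finitely_supported_le h => k.
by rewrite oppr_eq0.
Qed.

Lemma lattice_sum_reindex phi F : bijective phi ->
  lattice_sum (fun k => F (phi k)) = lattice_sum F.
Proof. by move=> bphi; rewrite /lattice_sum -(reindex_fsbigT _ _ bphi). Qed.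

Lemma box_size (B : 'I_m -> nat) (s : seq 'cV[int]_m) :
  uniq s -> (forall k, k \in s -> box B k) -> (size s <= \prod_i (B i).*2.+1)%N.
Proof.
move=> us sB; pose P := (\sum_i (B i).*2)%N.
have BP i : ((B i).*2 <= P)%N by rewrite /P (bigD1 i)//= leq_addr.
pose f k : {ffun 'I_m -> 'I_P.+1} := [ffun i =>
  inord (absz (k i 0 + (B i)%:Z)%R)].
pose Fa i := [pred x : 'I_P.+1 | (x <= (B i).*2)%N].
have fE k i : box B k -> (f k i)%:Z = k i 0%R + (B i)%:Z :> int /\ (f k i <= (B
  i).*2)%N.
  move=> /(_ i) kB; have k1 : - (B i)%:Z <= k i 0%R <= (B i)%:Z.
    by rewrite -ler_norml -abszE lez_nat.
  have h0 : 0 <= k i 0%R + (B i)%:Z by lia.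
  have h1 : (absz (k i 0 + (B i)%:Z)%R <= (B i).*2)%N
    by rewrite -lez_nat gez0_abs// -addnn PoszD; lia.
  rewrite ffunE inordK ?ltnS ?(leq_trans h1)//; split=> //.
  by rewrite gez0_abs.
have uf : uniq (map f s).
  rewrite map_inj_in_uniq// => k l ks ls fkl; apply/colP => i.
  have [e1 _] := fE k i (sB k ks); have [e2 _] := fE l i (sB l ls).
  by apply: (addIr (B i)%:Z); rewrite -e1 -e2 fkl.
rewrite -(size_map f); apply: (@leq_trans #|family Fa|).
  rewrite cardE; apply: uniq_leq_size => // _ /mapP[k ks ->]; rewrite mem_enum.
  by apply/familyP => i; rewrite inE; exact: (fE k i (sB k ks)).2.
rewrite card_family foldrE big_map big_enum /=.
apply: leq_prod => i _; rewrite cardE -(size_map val) -[leqRHS](size_iota 0).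
apply: uniq_leq_size; first by rewrite map_inj_uniq ?enum_uniq//;
  exact: val_inj.
by move=> _ /mapP[x + ->]; rewrite mem_enum mem_iota.
Qed.

Lemma finite_box B : finite_set (box B).
Proof.
apply: contrapT => /(infinite_set_fset (\prod_i (B i).*2.+1).+1)[D DB].
rewrite leqNgt => /negP; apply; rewrite ltnS; apply: box_size.
  exact: fset_uniq.
by move=> k kD; apply: DB.
Qed.

Lemma finitely_supported_box F B : (forall k,
  F k != 0 -> box B k) -> finitely_supported F.
Proof. by move=> FB; apply: sub_finite_set (finite_box B) => k /=;
  exact: FB. Qed.

(** Counting through an injection [beta] into a box: the shell around a zero set
    is no box, but rounding the height above it is an injection of it into
    one. *)
Lemma lattice_sum_bound F c B (beta : 'cV[int]_m -> 'cV[int]_m) :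
  injective beta -> 0 <= c -> (forall k, F k <= c) ->
  (forall k, F k != 0 -> box B (beta k)) ->
  lattice_sum F <= c * (\prod_i (B i).*2.+1)%N%:R.
Proof.
move=> ib c0 Fc FB; rewrite /lattice_sum.
have [fin|inf] := pselect (finite_set ([set: 'cV[int]_m] `&` F @^-1` [set~ 0]));
  last first.
  by rewrite no_finite_support// big_nil mulr_ge0.
apply: (@le_trans _ _ (\sum_(k <- finite_support 0 setT F) c));
  first exact: ler_sum.
rewrite big_const_seq count_predT iter_addr_0 -[leLHS]mulr_natr ler_wpM2l//
  ler_nat.
rewrite -(size_map beta); apply: box_size.
  by rewrite map_inj_uniq// finite_support_uniq.
move=> _ /mapP[k + ->]; rewrite in_finite_support// inE => -[_ /= /eqP].
exact: FB.
Qed.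

Lemma lattice_sum_lower F c (q : nat) (k0 : 'cV[int]_m) :
  finitely_supported F -> (forall k, 0 <= F k) ->
  (forall j : 'I_m -> nat, (forall i, (j i < q)%N) ->
     c <= F (\col_i (k0 i 0 + (j i)%:Z))) ->
  c * (q ^ m)%N%:R <= lattice_sum F.
Proof.
move=> fF F0 Fc.
pose f (j : {ffun 'I_m -> 'I_q}) : 'cV[int]_m :=
  \col_i (k0 i 0 + (j i : nat)%:Z).
have finj : injective f.
  move=> j j' /colP jj; apply/ffunP => i; apply: val_inj => /=.
  by have := jj i; rewrite !mxE => /addrI [].
pose D := [set k | F k != 0] `|` [set` [seq f j | j <- enum {ffun 'I_m ->
  'I_q}]].
have fD : finite_set D by rewrite finite_setU; split=> //; exact: finite_seq.
rewrite (@lattice_sum_seq _ D)//; last by move=> k; left.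
pose r := [seq f j | j <- enum {ffun 'I_m -> 'I_q}].
have ur : uniq r by rewrite map_inj_uniq ?enum_uniq.
have rE : [seq k <- fset_set D | k \in r] =i r.
  move=> k; rewrite mem_filter andbC in_fset_set//.
  case kr : (k \in r); last by rewrite andbF.
  by rewrite andbT; apply/mem_set; right.
rewrite (bigID (mem r))/= -[leLHS]addr0 lerD ?sumr_ge0//.
rewrite -big_filter (perm_big r) /=; last first.
  by apply: uniq_perm; rewrite ?filter_uniq ?fset_uniq.
rewrite big_map big_enum /=.
apply: (@le_trans _ _ (\sum_(j : {ffun 'I_m -> 'I_q}) c)).
  by rewrite sumr_const card_ffun !card_ord mulr_natr.
by apply: ler_sum => j _; apply: (Fc (fun i => j i)) => i.
Qed.

End LatticeSums.

(** * Volume as asymptotic density of lattice points *)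

Section Average.
Context {R : realType} {n : nat}.
Implicit Types (u v w p : 'cV[R]_n.+1) (s : 'cV[R]_n.+1 -> R).
Implicit Types (X Y : 'cV[R]_n.+1 -> R) (k l : 'cV[int]_n.+1) (N M : nat).

(** The cut-off at scale [N]. It is invariant under the Lorentz group, and being
    Lipschitz rather than a sharp cut-off it changes by [O(1 / N)] only when a
    vector of length [O(N)] moves by a bounded distance. *)
Definition weight N v : R := Num.max 0 (1 - ldot v v / N%:R ^+ 2).
Definition weighted X N k : R := X (zvec k) * weight N (zvec k).
Definition avg_seq X N : R := lattice_sum (weighted X N) / N%:R ^+ n.+1.
Definition avg X : R := ulim (avg_seq X).

(** Under this condition the product of [X] with the cut-off vanishes outside a
    ball of radius [O(N)]. *)
Definition spacelike_supported L X := forall v,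
  X v != 0 -> enorm v <= L * ldot v v.
Definition admissible X := exists L c : R, [/\ 1 <= L, 0 <= c,
  forall v, `|X v| <= c & spacelike_supported L X].

Lemma weight_ge0 N v : 0 <= weight N v.
Proof. by rewrite /weight le_max lexx. Qed.

Lemma weight_le1 N v : 0 <= ldot v v -> weight N v <= 1.
Proof.
by move=> vv; rewrite /weight ge_max ler01 gerBl divr_ge0// sqr_ge0.
Qed.

Lemma weight_neq0 N v : (0 < N)%N -> weight N v != 0 -> ldot v v <= N%:R ^+ 2.
Proof.
move=> N0; rewrite /weight; apply: contraR; rewrite -ltNge => lt.
apply/eqP/max_idPl; rewrite subr_le0 ler_pdivlMr ?exprn_gt0 ?ltr0n//.
by rewrite mul1r ltW.
Qed.

Lemma box_of_enorm M N k : enorm (zvec k : 'cV[R]_n.+1) <= (M * N)%:R ^+ 2 ->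
  box (fun=> (M * N)%N) k.
Proof.
move=> H i; have := le_trans (coord_enorm (zvec k : 'cV[R]_n.+1) i) H.
rewrite mxE -real_normK ?num_real// -intr_norm ler_pXn2r ?nnegrE ?ler0n//.
by rewrite -abszE -[(_)%:~R]/((absz (k i 0))%:R) ler_nat.
Qed.

Lemma sqr_archi (L : R) : 1 <= L -> exists2 M, (0 < M)%N & L <= M%:R ^+ 2.
Proof.
move=> L1; exists (Num.bound L); have := archi_boundP (le_trans ler01 L1).
  by move=> /(le_lt_trans L1); rewrite ltr1n => /ltnW.
by move=> lt; have := le_lt_trans L1 lt; nra.
Qed.

Lemma weighted_box L X M N k : 0 <= L -> L <= M%:R ^+ 2 -> (0 < N)%N ->
  spacelike_supported L X -> weighted X N k != 0 -> box (fun=> (M * N)%N) k.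
Proof.
move=> L0 LM N0 XL; rewrite mulf_eq0 negb_or =>
  /andP[/XL EL /(weight_neq0 N0) QN].
apply: box_of_enorm; apply: le_trans EL _; rewrite natrM exprMn.
apply: (@le_trans _ _ (L * N%:R ^+ 2)); first by rewrite ler_wpM2l.
by rewrite ler_wpM2r// sqr_ge0.
Qed.

Lemma spacelike_ge0 (L : R) v : 1 <= L -> enorm v <= L * ldot v v ->
  0 <= ldot v v.
Proof. by move=> L1; have := enorm_ge0 v; nra. Qed.

Lemma weighted_le X c L N k : 1 <= L -> (forall v, `|X v| <= c) ->
  spacelike_supported L X -> `|weighted X N k| <= c.
Proof.
move=> L1 Xc XL; rewrite /weighted; have [->|/XL EL] := eqVneq (X (zvec k)) 0.
  by rewrite mul0r normr0; apply: le_trans (Xc 0).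
have q0 : 0 <= ldot (zvec k : 'cV[R]_n.+1) (zvec k).
  exact: spacelike_ge0 L1 EL.
rewrite normrM (ger0_norm (weight_ge0 _ _)) -[leRHS]mulr1.
by apply: ler_pM => //; rewrite ?weight_ge0// weight_le1.
Qed.

Lemma weighted_finite X N : (0 < N)%N -> admissible X ->
  finitely_supported (weighted X N).
Proof.
move=> N0 [L [c [L1 c0 Xc XL]]]; have [M M0 LM] := sqr_archi L1.
by apply: finitely_supported_box => k; apply: (weighted_box _ LM N0 XL); lra.
Qed.

Lemma box_prod M : (\prod_(i < n.+1) (M.*2.+1) = M.*2.+1 ^ n.+1)%N.
Proof. by rewrite prod_nat_const card_ord. Qed.

Lemma double_le M N : (0 < M)%N -> (0 < N)%N -> ((M * N).*2.+1 <= 3 * M * N)%N.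
Proof. by move=> M0 N0; rewrite -mulnA;
  have : (0 < M * N)%N by [rewrite muln_gt0 M0]; lia. Qed.

Lemma avg_seq_le X c M N : (0 < M)%N -> (0 < N)%N -> 0 <= c ->
  (forall k, weighted X N k <= c) ->
  (forall k, weighted X N k != 0 -> box (fun=> (M * N)%N) k) ->
  avg_seq X N <= c * (3 * M)%:R ^+ n.+1.
Proof.
move=> M0 N0 c0 Xc XB; rewrite /avg_seq ler_pdivrMr ?exprn_gt0 ?ltr0n//.
apply: le_trans (lattice_sum_bound (@inj_id _) c0 Xc XB) _.
rewrite box_prod -mulrA ler_wpM2l// -exprMn -natrM -natrX ler_nat.
by rewrite leq_exp2r// double_le.
Qed.

Lemma weightedN X N k : weighted (fun v => - X v) N k = - weighted X N k.
Proof. by rewrite /weighted mulNr. Qed.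

Lemma avg_seqN X N : avg_seq (fun v => - X v) N = - avg_seq X N.
Proof.
rewrite /avg_seq -mulNr -lattice_sumN; congr (lattice_sum _ / _).
by apply/funext => k; rewrite weightedN.
Qed.

Lemma avg_seq_bounded X : admissible X -> bounded_seq (avg_seq X).
Proof.
move=> [L [c [L1 c0 Xc XL]]]; have [M M0 LM] := sqr_archi L1.
exists (c * (3 * M)%:R ^+ n.+1); near=> N.
have N0 : (0 < N)%N by near: N; exact: nbhs_infty_gt.
have XB k : weighted X N k != 0 -> box (fun=> (M * N)%N) k.
  by apply: (weighted_box _ LM N0 XL); lra.
have Wc k := weighted_le N k L1 Xc XL.
rewrite ler_norml; apply/andP; split.
  rewrite lerNl -avg_seqN; apply: avg_seq_le => // k; rewrite weightedN.
    by apply: le_trans (Wc k); rewrite -normrN ler_norm.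
  by rewrite oppr_eq0; exact: XB.
by apply: avg_seq_le => // k; apply: le_trans (Wc k); exact: ler_norm.
Unshelve. all: by end_near. Qed.

Lemma admissibleD X Y : admissible X -> admissible Y ->
  admissible (fun v => X v + Y v).
Proof.
move=> [L [c [L1 c0 Xc XL]]] [L' [c' [L1' c0' Yc YL]]].
exists (L + L'), (c + c'); split; [lra|lra| |].
  by move=> v; apply: le_trans (ler_normD _ _) (lerD _ _).
move=> v; have [-> | Xv _] := eqVneq (X v) 0.
  by rewrite add0r => /YL; have := enorm_ge0 v; nra.
by have := XL v Xv; have := enorm_ge0 v; nra.
Qed.

Lemma avgD X Y : admissible X -> admissible Y ->
  avg (fun v => X v + Y v) = avg X + avg Y.
Proof.
move=> aX aY; rewrite -ulimD; try exact: avg_seq_bounded.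
apply: (@ulim_eq _ _ _ 0).
- by apply: avg_seq_bounded; exact: admissibleD.
- by apply: bounded_seqD; exact: avg_seq_bounded.
near=> N; have N0 : (0 < N)%N by near: N; exact: nbhs_infty_gt.
rewrite mul0r normr_le0 subr_eq0 /avg_seq -mulrDl -lattice_sumD;
  try exact: weighted_finite.
apply/eqP; congr (lattice_sum _ / _); apply/funext => k.
by rewrite /weighted mulrDl.
Unshelve. all: by end_near. Qed.

Lemma avg_le X Y : admissible X -> admissible Y -> (forall v, X v <= Y v) ->
  avg X <= avg Y.
Proof.
move=> aX aY XY; apply: ulim_le; try exact: avg_seq_bounded.
near=> N; have N0 : (0 < N)%N by near: N; exact: nbhs_infty_gt.
rewrite /avg_seq ler_wpM2r ?invr_ge0 ?exprn_ge0//.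
apply: lattice_sum_le; try exact: weighted_finite.
by move=> k; rewrite /weighted ler_wpM2r ?weight_ge0.
Unshelve. all: by end_near. Qed.

Lemma avg0 : avg (fun=> 0) = 0.
Proof.
rewrite -[RHS](@ulim_cst R 0); congr ulim; apply/funext => N.
rewrite /avg_seq (_ : weighted _ _ = fun=> 0).
  by rewrite /lattice_sum fsbig1 ?mul0r.
by apply/funext => k; rewrite /weighted mul0r.
Qed.

Lemma enorm_le_coord v (b : R) : (forall i, `|v i 0| <= b) ->
  enorm v <= n.+1%:R * b ^+ 2.
Proof.
move=> vb; rewrite enormE [leRHS](_ : _ = \sum_(i < n.+1) b ^+ 2).
  apply: ler_sum => i _; rewrite -real_normK ?num_real//.
  by rewrite lerXn2r ?nnegrE// (le_trans (normr_ge0 _) (vb i)).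
by rewrite sumr_const card_ord mulr_natl.
Qed.

Lemma ldot_le_enorm v : ldot v v <= enorm v.
Proof. by rewrite enorm_ldot lerDl mulr_ge0// sqr_ge0. Qed.

(** The lattice points at scale [N] in a shrunken copy of the cube number at
    least a fixed multiple of [N ^ (n + 1)], and the cut-off is at least [1 / 2]
    there. That [kappa] depends on the size and the position of the cube only is
    what [pinched_near] needs. *)
Lemma avg_lower (b r : R) : 0 <= b -> 0 < r -> exists2 kappa : R, 0 < kappa &
  forall X p, admissible X -> (forall v, 0 <= X v) ->
    (forall (t : R) v, 0 < t -> X (t *: v) = X v) ->
    (forall i, `|p i 0| <= b) ->
    (forall v, (forall i, `|v i 0 - p i 0| <= r) -> 1 <= X v) ->
    kappa <= avg X.
Proof.
move=> b0 r0; pose m : R := n.+1%:R.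
have m1 : 1 <= m by rewrite ler1n.
(* the cube is shrunk until it lies well inside the unit ball *)
pose la := (2 * m * (b + r + 1))^-1.
have la0 : 0 < la by rewrite invr_gt0 !mulr_gt0//; lra.
have laE : la * (m * (b + r + 1)) = 1 / 2.
  by rewrite /la; field; rewrite gt_eqF//=; lra.
exists (1 / 2 * (la * r / 2) ^+ n.+1).
  by rewrite mulr_gt0// exprn_gt0// divr_gt0// mulr_gt0.
move=> X p aX X0 Xh pb Xp; apply: ulim_ge_cst; first exact: avg_seq_bounded.
near=> N; have N0 : (0 < N)%N by near: N; exact: nbhs_infty_gt.
have N0' : 0 < N%:R :> R by rewrite ltr0n.
have large : 2 / N%:R < la * r.
  by near: N; apply: near_inv_lt; rewrite mulr_gt0.
rewrite ltr_pdivrMr// in large.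
pose t := N%:R * la; have t0 : 0 < t by rewrite mulr_gt0.
pose q := absz (Num.floor (t * r)).
have qE : q%:R = (Num.floor (t * r))%:~R :> R.
  have f0 : 0 <= Num.floor (t * r) by rewrite floor_ge_int mulr_ge0// ltW.
  by rewrite -[q%:R]/((Posz q)%:~R) gez0_abs.
have qle : q%:R <= t * r by rewrite qE; exact: floor_le.
have qge : t * r / 2 <= q%:R.
  have /andP[_] := floor_itv (t * r); rewrite intrD -qE.
  by rewrite /t in large *; nra.
rewrite /avg_seq ler_pdivlMr ?exprn_gt0//.
apply: (@le_trans _ _ (1 / 2 * (q ^ n.+1)%N%:R)).
  rewrite -[X in X <= _]mulrA -exprMn ler_wpM2l//.
  rewrite natrX lerXn2r ?nnegrE ?ler0n//.
    by rewrite !mulr_ge0// ltW.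
  by apply: le_trans qge; rewrite /t le_eqVlt; apply/orP; left; apply/eqP; ring.
apply: (@lattice_sum_lower _ _ _ _ _ (\col_i Num.floor (t * p i 0))).
- exact: weighted_finite.
- by move=> k; rewrite mulr_ge0// weight_ge0.
move=> j jq; set k := (X in weighted _ _ X).
have kp i : `|(zvec k) i 0 - t * p i 0| <= t * r.
  rewrite !mxE intrD -[(Posz _)%:~R]/((j i)%:R).
  have /andP[f1] := floor_itv (t * p i 0); rewrite intrD => f2.
  have : (j i)%:R + 1 <= q%:R :> R by rewrite natr1 ler_nat.
  have := ler0n R (j i); rewrite /t in large qle f1 f2 *.
  by rewrite ler_norml; lra.
have Xk : 1 <= X (zvec k).
  rewrite -(Xh t^-1) ?invr_gt0//; apply: Xp => i; rewrite mxE.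
  rewrite -(ler_pM2l t0) -[X in X * `|_|](gtr0_norm t0) -normrM mulrBr.
  by rewrite mulVKf ?gt_eqF.
have wk : 1 / 2 <= weight N (zvec k).
  rewrite /weight le_max; apply/orP; right.
  set z := (X in 1 - X); suff : z <= 1 / 2 by lra.
  rewrite /z.
  rewrite ler_pdivrMr ?exprn_gt0//; apply: le_trans (ldot_le_enorm _) _.
  apply: le_trans (@enorm_le_coord _ (t * (b + r)) _) _.
    move=> i; have := kp i; have := pb i;
      rewrite !ler_norml => /andP[h1 h2] /andP[h3 h4].
    by apply/andP; split; nra.
  rewrite -/m; have h : m * (la * (b + r)) <= 1 / 2 by nra.
  have h' : 0 <= la * (b + r) by rewrite mulr_ge0 ?ltW//; lra.
  have : m * (la * (b + r)) ^+ 2 <= 1 / 2 by nra.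
  rewrite /t => h''; have -> : m * (N%:R * la * (b + r)) ^+ 2 = (m * (la * (b +
    r)) ^+ 2) * N%:R ^+ 2 by ring.
  by rewrite ler_wpM2r// sqr_ge0.
by rewrite /weighted -[leLHS]mul1r ler_pM//; lra.
Unshelve. all: by end_near. Qed.

End Average.

(** * The distance between time functions *)

Section HalfspaceDistance.
Context {R : realType} {n : nat}.
Implicit Types (u v w p : 'cV[R]_n.+1) (s a b c : 'cV[R]_n.+1 -> R).
Implicit Types (k l : 'cV[int]_n.+1) (N M : nat) (g : SO R n).

Definition separates s s' v : R := `|(0 < s v)%R%:R - (0 < s' v)%R%:R|.
(** The volume of the region between the two zero sets in the unit slab. For two
    points of hyperbolic space this is, up to a factor, the invariant measure of
    the set of walls that separate them. *)
Definition hdist s s' : R := avg (separates s s').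

Lemma separatesC s s' : separates s s' = separates s' s.
Proof. by apply/funext => v; rewrite /separates distrC. Qed.

Lemma separates_ge0 s s' v : 0 <= separates s s' v.
Proof. exact: normr_ge0. Qed.

Lemma separates_le1 s s' v : separates s s' v <= 1.
Proof.
by rewrite /separates; case: (0 < s v); case: (0 < s' v);
  rewrite ?subrr ?normr0 ?subr0 ?sub0r ?normrN ?normr1.
Qed.

Lemma separates_neq0 s s' v : separates s s' v != 0 ->
  (s v <= 0 /\ 0 < s' v) \/ (s' v <= 0 /\ 0 < s v).
Proof.
by rewrite /separates; case: (ltP 0 (s v)); case: (ltP 0 (s' v)) => ? ?;
  rewrite ?subrr ?normr0 ?eqxx// => _; [right|left].
Qed.

Lemma separates1 s s' v : s v <= 0 -> 0 < s' v -> separates s s' v = 1.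
Proof.
by move=> sv sv'; rewrite /separates sv' ltNge sv /= sub0r normrN normr1.
Qed.

Lemma separatesZ s s' (t : R) v : time_function s -> time_function s' ->
  0 < t -> separates s s' (t *: v) = separates s s' v.
Proof.
by move=> S S' t0; rewrite /separates (tf_scale S) (tf_scale S') !pmulr_rgt0.
Qed.

Lemma separates_triangle a b c v :
  separates a c v <= separates a b v + separates b c v.
Proof. exact: ler_distD. Qed.

(** For sign functions betweenness of the heights is enough: a wall that
    separates [a] from [c] separates exactly one of the two pairs. *)
Lemma separates_btw a b c v : btw (a v) (b v) (c v) ->
  separates a b v + separates b c v = separates a c v.
Proof.
rewrite /btw /separates; case: (ltP 0 (a v)) => ha; case: (ltP 0 (b v)) => hb;
  case: (ltP 0 (c v)) => hc; rewrite ?subrr ?subr0 ?sub0r ?normrN ?normr0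
    ?normr1 ?addr0 ?add0r// => /orP h;
  exfalso; lra.
Qed.

Lemma separates_spacelike s s' L : 1 <= L -> time_function s ->
  time_function s' -> pinched L s -> pinched L s' ->
  spacelike_supported L (separates s s').
Proof.
move=> L1 S S' P P' v /separates_neq0[[h /ltW h']|[h /ltW h']].
  exact: pinched_between L1 S S' P P' h h'.
exact: pinched_between L1 S' S P' P h h'.
Qed.

Lemma separates_admissible s s' L : 1 <= L -> time_function s ->
  time_function s' -> pinched L s -> pinched L s' ->
  admissible (separates s s').
Proof.
move=> L1 S S' P P'; exists L, 1; split => //.
  by move=> v; rewrite ger0_norm ?separates_ge0// separates_le1.
exact: separates_spacelike.
Qed.

Lemma hdistC s s' : hdist s s' = hdist s' s.
Proof. by rewrite /hdist separatesC. Qed.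

Lemma hdistxx s : hdist s s = 0.
Proof.
rewrite -[RHS](@avg0 R n); congr avg; apply/funext => v.
by rewrite /separates subrr normr0.
Qed.

Lemma tf_coord_lip s v w (r : R) : time_function s ->
  (forall i, `|v i 0 - w i 0| <= r) -> `|s v - s w| <= 2 * n.+1%:R * r.
Proof.
move=> S vw; have r0 : 0 <= r := le_trans (normr_ge0 _) (vw 0).
rewrite -mulrA; apply: tf_lip => //; first by rewrite mulr_ge0.
apply: le_trans (@enorm_le_coord _ _ _ r _) _.
  by move=> i; rewrite !mxE.
rewrite exprMn ler_wpM2r ?sqr_ge0// -natrX ler_nat expnS leq_pmulr//.
Qed.

Section ThreePoints.
Variables (a b c : 'cV[R]_n.+1 -> R) (L : R).
Hypotheses (L1 : 1 <= L).
Hypotheses (Ta : time_function a) (Tb : time_function b) (Tc : time_function c).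
Hypotheses (Pa : pinched L a) (Pb : pinched L b) (Pc : pinched L c).

Let adm_ab : admissible (separates a b).
Proof. exact: separates_admissible L1 Ta Tb Pa Pb. Qed.
Let adm_bc : admissible (separates b c).
Proof. exact: separates_admissible L1 Tb Tc Pb Pc. Qed.
Let adm_ac : admissible (separates a c).
Proof. exact: separates_admissible L1 Ta Tc Pa Pc. Qed.

Lemma hdist_triangle : hdist a c <= hdist a b + hdist b c.
Proof.
rewrite /hdist -avgD//; apply: avg_le => //; first exact: admissibleD.
exact: separates_triangle.
Qed.

Lemma hdist_btw : (forall v, btw (a v) (b v) (c v)) ->
  hdist a b + hdist b c = hdist a c.
Proof.
move=> H; rewrite /hdist -avgD//; congr avg; apply/funext => v.
exact: separates_btw.
Qed.

(** Equality in the triangle inequality forces betweenness: otherwise an open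
    cone of walls is counted twice on the left and not at all on the right. *)
Lemma hdist_btw_inv v : hdist a b + hdist b c = hdist a c ->
  btw (a v) (b v) (c v).
Proof.
wlog hb : v / Num.max (a v) (c v) < b v => [H e|].
  apply/negPn/negP; rewrite /btw negb_or !negb_and -!ltNge => h.
  have [lt|ge] := ltP (Num.max (a v) (c v)) (b v).
    by have := H v lt e; apply/negP; rewrite /btw negb_or !negb_and -!ltNge.
  have lt : Num.max (a (- v)) (c (- v)) < b (- v).
    rewrite !(tfN v)// gt_max !ltrN2.
    by move: ge h; rewrite le_max => /orP ge /andP[/orP h1 /orP h2]; lra.
  have := H (- v) lt e; rewrite !(tfN v)// /btw => /orP k.
  by move: ge h; rewrite le_max => /orP ge /andP[/orP h1 /orP h2]; lra.
move=> e; exfalso.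
set t := Num.max (a v) (c v) in hb.
have at' : a v <= t by rewrite le_max lexx.
have ct : c v <= t by rewrite le_max lexx orbT.
pose h := b v - t; have h0 : 0 < h by rewrite subr_gt0.
pose p := v + (- (t + h / 2)) *: tvec.
pose r := h / (8 * n.+1%:R); have r0 : 0 < r by rewrite divr_gt0// mulr_gt0.
have rE : 2 * n.+1%:R * r = h / 4 by rewrite /r; field; rewrite gt_eqF//= ltr0n.
pose B := \sum_i `|p i 0|.
have [kappa k0 H] := @avg_lower R n B r (sumr_ge0 _ (fun i _ =>
  normr_ge0 _)) r0.
pose Z v := separates a b v + separates b c v - separates a c v.
have admZ : admissible Z.
  apply: admissibleD; first exact: admissibleD.
  have [L' [d [L1' d0 hd hL]]] := adm_ac.
  exists L', d; split=> // w; first by rewrite normrN.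
  by rewrite oppr_eq0; exact: hL.
have : kappa <= avg Z.
  apply: (H Z p) => //.
  - by move=> w; rewrite subr_ge0 separates_triangle.
  - by move=> x w x0; rewrite /Z !separatesZ.
  - by move=> i; rewrite /B (bigD1 i)//= lerDl sumr_ge0.
  move=> w wp.
  have la := tf_coord_lip Ta wp; have lb := tf_coord_lip Tb wp.
  have lc := tf_coord_lip Tc wp.
  move: la lb lc; rewrite rE /p !tf_shift// !ler_norml =>
    /andP[la1 la2] /andP[lb1 lb2] /andP[lc1 lc2].
  have wa : a w <= 0 by lra.
  have wb : 0 < b w by rewrite /h in la1 la2 lb1 lb2 *; lra.
  have wc : c w <= 0 by lra.
  rewrite /Z (separates1 wa wb) separatesC (separates1 wc wb).
  have -> : separates a c w = 0.
    by rewrite /separates !ltNge wa wc /= subrr normr0.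
  lra.
move/(lt_le_trans k0).
have : avg Z + hdist a c = hdist a b + hdist b c.
  rewrite /hdist -!avgD//; congr avg; apply/funext => w; rewrite /Z; ring.
by rewrite e => /eqP; rewrite -subr_eq0 addrK => /eqP ->; rewrite ltxx.
Qed.

End ThreePoints.

Lemma hdist_eq0 a b L : 1 <= L -> time_function a -> time_function b ->
  pinched L a -> pinched L b -> hdist a b = 0 -> a = b.
Proof.
move=> L1 Ta Tb Pa Pb e; apply/funext => v.
have e2 : hdist a b + hdist b a = hdist a a
  by rewrite (hdistC b) e hdistxx addr0.
have := hdist_btw_inv L1 Ta Tb Ta Pa Pb Pa v e2.
by rewrite /btw orbb -eq_le => /eqP.
Qed.

(** Each line in the time direction contains at most [2 a + 1] lattice points
    within [a] of a zero set, since the height grows by [1] from one to the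
    next. So these points make up a vanishing proportion of a large box. *)
Lemma shell_sum s (F : 'cV[int]_n.+1 -> R) (a M : nat) : time_function s ->
  (forall k, F k <= 1) ->
  (forall k, F k != 0 -> `|s (zvec k)| <= a%:R /\ box (fun=> M) k) ->
  lattice_sum F <= ((M.*2.+1) ^ n * (a.*2.+1))%N%:R.
Proof.
move=> S F1 Fs.
pose beta k : 'cV[int]_n.+1 :=
  \col_i (if i == ord_max then Num.floor (s (zvec k)) else k i 0).
pose B (i : 'I_n.+1) := if i == ord_max then a else M.
have -> : (M.*2.+1 ^ n * a.*2.+1 = \prod_i (B i).*2.+1)%N.
  rewrite (bigD1 ord_max)//= {1}/B eqxx mulnC; congr (_ * _)%N.
  rewrite (eq_bigr (fun=> M.*2.+1)); last by move=> i /negPf ni; rewrite /B ni.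
  by rewrite prod_nat_const cardC1 card_ord.
rewrite -[leRHS]mul1r; apply: (@lattice_sum_bound _ _ _ _ _ beta) =>
  // [k l kl|k Fk i].
  pose d := k ord_max 0 - l ord_max 0.
  have zk : zvec k = zvec l + (d%:~R : R) *: tvec.
    apply/colP => i; rewrite !mxE; case: (eqVneq i ord_max) => [->|ni].
      by rewrite mulr1 -intrD /d addrC subrK.
    have := congr1 (fun x : 'cV_n.+1 => x i 0) kl;
      rewrite !mxE (negPf ni) => ->.
    by rewrite mulr0 addr0.
  have d0 : d = 0.
    have := congr1 (fun x : 'cV_n.+1 => x ord_max 0) kl; rewrite !mxE eqxx zk.
    rewrite (tf_shift S) floorDrz ?intr_int// intrKfloor => /eqP.
    by rewrite -[X in _ == X]addr0 => /eqP/addrI.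
  apply/colP => i; case: (eqVneq i ord_max) => [->|ni].
    by apply/eqP; rewrite -subr_eq0 -/d d0.
  by have := congr1 (fun x : 'cV_n.+1 => x i 0) kl; rewrite !mxE (negPf ni).
have [sa kM] := Fs k Fk; rewrite mxE /B; case: eqP => // _.
rewrite -lez_nat abszE ler_norml; move: sa; rewrite ler_norml => /andP[s1 s2].
apply/andP; split; first by rewrite floor_ge_int intrN.
by rewrite -(ler_int R); apply: le_trans s2; exact: floor_le.
Qed.

(** By homogeneity the two zero sets differ by at most [d] times the length of a
    vector, so the points between them at scale [N] lie in a shell of width
    [O(d * N)] around one of them, and [shell_sum] applies. *)
Lemma hdist_small L : 1 <= L -> exists2 C : R, 0 < C &
  forall s s' (d : R), time_function s -> time_function s' ->
    pinched L s -> pinched L s' -> 0 < d ->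
    (forall v, (forall i, `|v i 0| <= 1) -> `|s v - s' v| <= d) ->
    hdist s s' <= C * d.
Proof.
move=> L1; have [M M0 LM] := sqr_archi L1.
exists ((3 * M)%:R ^+ n * (5 * M%:R)).
  by rewrite !mulr_gt0 ?exprn_gt0 ?ltr0n// muln_gt0.
move=> s s' d S S' P P' d0 ss.
have adm := separates_admissible L1 S S' P P'.
apply: ulim_le_cst; first exact: avg_seq_bounded.
near=> N; have N0 : (0 < N)%N by near: N; exact: nbhs_infty_gt.
have N0' : 0 < N%:R :> R by rewrite ltr0n.
have large : 1 / N%:R < d by near: N; exact: near_inv_lt.
rewrite ltr_pdivrMr// in large.
pose a := (absz (Num.floor (d * (M * N)%:R))).+1.
have aE : d * (M * N)%:R <= a%:R <= d * (M * N)%:R + 1.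
  have f0 : 0 <= Num.floor (d * (M * N)%:R)
    by rewrite floor_ge_int mulr_ge0// ltW.
  rewrite /a -natr1 -[(absz _)%:R]/((Posz (absz _))%:~R) gez0_abs//.
  have /andP[h1 h2] := floor_itv (d * (M * N)%:R); rewrite intrD in h2.
  by rewrite ltW//= lerD2r.
rewrite /avg_seq ler_pdivrMr ?exprn_gt0//.
have MN0 : 0 < (M * N)%:R :> R by rewrite ltr0n muln_gt0 M0.
apply: le_trans (@shell_sum s _ a (M * N) S _ _) _.
- move=> k; apply: le_trans (ler_norm _) _; apply: (weighted_le _ _ L1).
    by move=> v; rewrite ger0_norm ?separates_ge0// separates_le1.
  exact: separates_spacelike L1 S S' P P'.
- move=> k Fk; have kB : box (fun=> (M * N)%N) k.
    apply: weighted_box LM N0 _ Fk; first lra.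
    exact: separates_spacelike L1 S S' P P'.
  split=> //; apply: le_trans (_ : d * (M * N)%:R <= _); last by case/andP: aE.
  have : `|s (zvec k) - s' (zvec k)| <= d * (M * N)%:R.
    have := ss ((M * N)%:R^-1 *: zvec k);
      rewrite (tf_scale S) (tf_scale S') -mulrBr normrM.
    rewrite gtr0_norm ?invr_gt0// ler_pdivrMl// mulrC => -> // i.
    rewrite !mxE normrM gtr0_norm ?invr_gt0// ler_pdivrMl// mulr1 -intr_norm.
    by rewrite -abszE -[(_)%:~R]/((absz (k i 0))%:R) ler_nat; exact: kB.
  move: Fk; rewrite mulf_eq0 negb_or => /andP[/separates_neq0 h _].
  by rewrite !ler_norml => /andP[h1 h2]; apply/andP; case: h => -[h3 h4]; split;
    lra.
rewrite natrM natrX exprS [leRHS](_ :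
  _ = ((3 * M * N)%:R ^+ n) * (5 * M%:R * d * N%:R)); last first.
  rewrite [(3 * M * N)%:R]natrM exprMn; ring.
apply: ler_pM; rewrite ?exprn_ge0//.
  by rewrite lerXn2r ?nnegrE ?ler0n// ler_nat double_le.
rewrite -addn1 -muln2 natrD natrM; case/andP: aE => _.
rewrite natrM; have M1 : 1 <= M%:R :> R by rewrite ler1n.
have := mulr_gt0 d0 N0'; nra.
Unshelve. all: by end_near. Qed.

(** If the zero set of [s'] violated the conclusion, it would come close to the
    light cone over some space direction, and a cube whose size depends on [L]
    only would fit between it and the zero set of [s]. *)
Lemma pinched_near L : 1 <= L -> exists2 eps : R, 0 < eps &
  forall s s' L', time_function s -> time_function s' -> pinched L s ->
    1 <= L' -> pinched L' s' -> hdist s s' < eps -> pinched (4 * (L + 1)) s'.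
Proof.
move=> L1; pose eta := (L + 1)^-1.
have eta0 : 0 < eta by rewrite invr_gt0; lra.
have eta1 : eta * (L + 1) = 1 by rewrite mulVf// gt_eqF//; lra.
pose r := eta / (32 * n.+1%:R); have r0 : 0 < r by rewrite divr_gt0// mulr_gt0.
have rE : 2 * n.+1%:R * r = eta / 16 by rewrite /r; field;
  rewrite gt_eqF//= ltr0n.
have [eps e0 H] := @avg_lower R n 2 r (ler0n _ 2) r0.
exists eps => // s s' L' S S' P L1' P' lt.
have L4 : 1 <= 4 * (L + 1) by lra.
apply/(pinchedP L4 S') => v; rewrite leNgt; apply/negP => viol.
have [rho rho0 rhoE] : exists2 rho : R, 0 < rho & rho ^+ 2 = ip v v.
  exists (Num.sqrt (ip v v)); last by rewrite sqr_sqrtr// ip_ge0.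
  rewrite sqrtr_gt0 lt_neqAle ip_ge0 andbT eq_sym; apply/eqP => z0.
  have := tf_pinched v L1' S' P'; move: viol; rewrite z0 !mulr0.
  have := sqr_ge0 (tm v - s' v); nra.
(* Scale the space part to unit length; up to a sign the graph of [s'] is high
   over it. *)
have [u [uu ht']] : exists u, ip u u = 1 /\
    1 - eta / 2 <= tm u - s' u.
  pose e : R := if 0 <= tm v - s' v then 1 else -1.
  have e2 : e ^+ 2 = 1 by rewrite /e; case: ifP; rewrite ?sqrrN expr1n.
  exists ((e / rho) *: v); split.
    by rewrite ipZl ipZr mulrA -expr2 exprMn e2 mul1r exprVn rhoE mulVf// -rhoE
      expf_neq0// gt_eqF.
  rewrite tmZ (tf_scale S') -mulrBr.
  pose x := (tm v - s' v) / rho.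
  have xE : tm v - s' v = x * rho by rewrite /x divfK// gt_eqF.
  have ex : e / rho * (tm v - s' v) = e * x by rewrite /x; ring.
  have ex0 : 0 <= e * x.
    rewrite /e /x; case: ifPn; rewrite -?ltNge => h;
      first by rewrite mul1r divr_ge0// ltW.
    by rewrite mulN1r -mulNr divr_ge0// ?ltW// oppr_gt0.
  rewrite ex; move: viol; rewrite xE -rhoE exprMn.
  move=> viol'; have {viol'} viol :
    4 * (L + 1) - 1 < (4 * (L + 1) + 1) * x ^+ 2.
    by rewrite -(ltr_pM2r (exprn_gt0 2 rho0)) -[ltRHS]mulrA.
  have y2 : (e * x) ^+ 2 = x ^+ 2 by rewrite exprMn e2 mul1r.
  rewrite leNgt; apply/negP => lt2.
  have e12 : eta <= 1 / 2 by nra.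
  have : (e * x) ^+ 2 < (1 - eta / 2) ^+ 2 by rewrite ltr_pXn2r ?nnegrE//; lra.
  rewrite y2 => x2.
  have : (4 * (L + 1) + 1) * x ^+ 2 < (4 * (L + 1) + 1) * (1 - eta / 2) ^+ 2.
    by rewrite ltr_pM2l//; lra.
  have : (4 * (L + 1) + 1) * (1 - eta / 2) ^+ 2 = 4 * (L + 1) - 3 + eta ^+ 2 /
    4.
    transitivity (4 * (L + 1) * 1 - 4 * (eta * (L + 1)) + eta * (eta * (L + 1))
      + 1 - eta + eta ^+ 2 / 4); first by field.
    by rewrite eta1; ring.
  have : eta ^+ 2 <= 1 / 4 by nra.
  lra.
have e12 : eta <= 1 / 2 by nra.
have ht : tm u - s u <= 1 - eta.
  have := tf_pinched u L1 S P; rewrite uu mulr1 => h.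
  rewrite leNgt; apply/negP => lt2.
  have : (1 - eta) ^+ 2 < (tm u - s u) ^+ 2 by rewrite ltr_pXn2r ?nnegrE//; lra.
  move=> h2; have : (L + 1) * (1 - eta) ^+ 2 < (L + 1) * (tm u - s u) ^+ 2.
    by rewrite ltr_pM2l//; lra.
  have : (L + 1) * (1 - eta) ^+ 2 = (L + 1) - 2 * (eta * (L + 1)) + eta * (eta *
    (L + 1)) by ring.
  rewrite eta1; lra.
(* The centre of the cube, at a quarter of [eta] from both zero sets. *)
pose p := u + (1 - 3 / 4 * eta - tm u) *: tvec.
have tp : tm p = 1 - 3 / 4 * eta by rewrite !ldotE; ring.
have pp : ip p p = 1 by rewrite !(ipDl, ipDr, ipZl, ipZr) (ipC u) !ip_tvec uu;
  ring.
have : eps <= hdist s s'.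
  apply: (H _ p).
  - apply: (@separates_admissible _ _ (L + L')) => //; first lra.
      by apply: pinched_le P => //; lra.
    by apply: pinched_le P' => //; lra.
  - exact: separates_ge0.
  - by move=> t w t0; rewrite separatesZ.
  - move=> i; rewrite -(ler_pXn2r (ltn0Sn 1)) ?nnegrE// real_normK ?num_real//.
    by apply: le_trans (coord_enorm p i) _; rewrite /enorm pp tp; nra.
  move=> w wp; have := tf_coord_lip S wp; have := tf_coord_lip S' wp.
  rewrite rE /p !tf_shift// !ler_norml => /andP[h1 h2] /andP[h3 h4].
  rewrite separatesC separates1//; lra.
by rewrite leNgt lt.
Qed.

End HalfspaceDistance.

(** * Invariance of the distance *)

Section Invariance.
Context {R : realType} {n : nat}.
Implicit Types (u v w p : 'cV[R]_n.+1) (s : 'cV[R]_n.+1 -> R).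
Implicit Types (k l : 'cV[int]_n.+1) (N M : nat) (g : SO R n).

(** Young's inequality, used with [t] of the order of the length of [w], so that
    no square roots appear. *)
Lemma ldot_Young w v (t : R) :
  2 * t * `|ldot w v| <= enorm w + t ^+ 2 * enorm v.
Proof.
have P : 2 * t * ldot w v <= enorm w + t ^+ 2 * enorm v.
  have := ip_ge0 (w + (- t) *: v); have := sqr_ge0 (tm w + t * tm v).
  rewrite !(ipDl, ipDr, ipZl, ipZr) (ipC v w) /enorm /ldot; lra.
have Q : 2 * t * - ldot w v <= enorm w + t ^+ 2 * enorm v.
  have := ip_ge0 (w + t *: v); have := sqr_ge0 (tm w - t * tm v).
  rewrite !(ipDl, ipDr, ipZl, ipZr) (ipC v w) /enorm /ldot; lra.
by have [h|h] := ler0P (ldot w v).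
Qed.

Lemma ldot_abs_le v : `|ldot v v| <= enorm v.
Proof.
rewrite ler_norml ldot_le_enorm andbT /ldot /enorm.
by have := ip_ge0 v; have := sqr_ge0 (tm v); lra.
Qed.

Lemma weight_lip N v w :
  `|weight N v - weight N w| <= `|ldot v v - ldot w w| / N%:R ^+ 2.
Proof.
have -> : `|ldot v v - ldot w w| / N%:R ^+ 2 =
    `|(1 - ldot v v / N%:R ^+ 2) - (1 - ldot w w / N%:R ^+ 2)|.
  rewrite -[_ ^+ 2 in LHS]ger0_norm ?sqr_ge0// -normfV -normrM distrC.
  by congr `|_|; ring.
rewrite /weight /Num.max; case: ltP => h1; case: ltP => h2;
  rewrite ?subrr ?normr0 //.
  rewrite subr0 [X in X <= _]gtr0_norm// gtr0_norm; lra.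
rewrite sub0r normrN [X in X <= _]gtr0_norm// distrC gtr0_norm; lra.
Qed.

Lemma finitely_supported_comp (F : 'cV[int]_n.+1 -> R) phi : bijective phi ->
  finitely_supported F -> finitely_supported (fun k => F (phi k)).
Proof.
move=> bphi fF; apply: (@finite_preimage _ _ [set k | F k != 0] phi) => //.
by move=> k l _ _; exact: (bij_inj bphi).
Qed.

Lemma hat_almost_permutation g : almost_permutation (hat g).
Proof.
have P : almost_permutation (val g).
  by apply: det1_almost_permutation; have [] := set_valP g.
by case: (hat_val g) => -> //; exact: almost_permutationN.
Qed.

(** After a change of variables by the lattice bijection that shadows the
    Lorentz transformation, the two lattice sums differ by a bounded amount at
    the points near one of the two zero sets, of which there are [O(N ^ n)], and
    by [O(1 / N)] at each of the remaining points, of which there are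
    [O(N ^ (n + 1))]. *)
Lemma hdist_act g s s' L : 1 <= L -> time_function s -> time_function s' ->
  pinched L s -> pinched L s' ->
  hdist (tf_act g s) (tf_act g s') = hdist s s'.
Proof.
move=> L1 S S' P P'; set A := hat g^-1%g.
pose X := separates s s'.
pose Y := separates (tf_act g s) (tf_act g s').
have YX v : Y v = X (A *m v) by rewrite /Y /separates !tf_act_gt0.
have XL : spacelike_supported L X by exact: separates_spacelike.
have X01 v : 0 <= X v <= 1 by rewrite separates_ge0 separates_le1.
have LA : lorentz A by exact: hat_lorentz.
have admX : admissible X by exact: separates_admissible P'.
have admY : admissible Y.
  have [N gN] := entries_le_exists g.
  exists ((n.+1%:R * N) ^+ 2 * L + 1), 1; split=> //.
  - by rewrite lerDr mulr_ge0 ?sqr_ge0//; lra.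
  - by move=> v; rewrite ger0_norm ?separates_ge0// separates_le1.
  move=> v; rewrite YX => /XL h; have q0 := spacelike_ge0 L1 h.
  rewrite LA in h q0; rewrite -{1}[v](hatKV g) mulrDl mul1r.
  apply: ler_wpDr => //; apply: le_trans (hat_enorm _ gN) _.
  by rewrite -mulrA ler_wpM2l// sqr_ge0.
have [C [phi [bphi HC]]] := hat_almost_permutation g^-1%g.
rewrite -/A in HC.
have C0 : 0 <= C := le_trans (normr_ge0 _) (HC 0 0).
pose c := Num.bound C.
have Cc k i : `|(A *m zvec k) i 0 - (zvec (phi k) : 'cV[R]_n.+1) i 0| <= c%:R.
  by rewrite [X in _ - X]mxE (le_trans (HC k i))// ltW// archi_boundP.
have [M M0 LM] := sqr_archi L1.
pose a := (2 * n.+1 * c)%N; pose M' := (M + c)%N.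
have M'0 : (0 < M')%N by rewrite addn_gt0 M0.
pose K : R := n.+1%:R * (M'%:R ^+ 2 + 2 * c%:R ^+ 2).
have K0 : 0 <= K by rewrite mulr_ge0// addr_ge0 ?mulr_ge0 ?sqr_ge0.
pose D : R := 2 * ((3 * M')%:R ^+ n * a.*2.+1%:R) + K * (3 * M')%:R ^+ n.+1.
apply: (@ulim_eq _ _ _ D); try exact: avg_seq_bounded.
near=> N; have N0 : (0 < N)%N by near: N; exact: nbhs_infty_gt.
have N0' : 0 < N%:R :> R by rewrite ltr0n.
pose inb l := [forall i, (absz (l i ord0) <= M' * N)%N].
pose G1 l : R := (inb l && (`|s (zvec l)| <= a%:R))%:R.
pose G2 l : R := (inb l && (`|s' (zvec l)| <= a%:R))%:R.
pose G3 l : R := K / N%:R * (inb l)%:R.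
have inbox l : inb l -> box (fun=> (M' * N)%N) l by move=> /forallP.
have sumG1 : lattice_sum G1 <= ((M' * N).*2.+1 ^ n * a.*2.+1)%N%:R.
  apply: (@shell_sum _ _ s) => // l; first by rewrite lern1 leq_b1.
  by rewrite pnatr_eq0 eqb0 negbK => /andP[/inbox ? ?].
have sumG2 : lattice_sum G2 <= ((M' * N).*2.+1 ^ n * a.*2.+1)%N%:R.
  apply: (@shell_sum _ _ s') => // l; first by rewrite lern1 leq_b1.
  by rewrite pnatr_eq0 eqb0 negbK => /andP[/inbox ? ?].
have KN : 0 <= K / N%:R by rewrite divr_ge0.
have G3box l : G3 l != 0 -> box (fun=> (M' * N)%N) l.
  by rewrite mulf_eq0 negb_or pnatr_eq0 eqb0 negbK => /andP[_ /inbox].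
have sumG3 : lattice_sum G3 <= K / N%:R * ((M' * N).*2.+1 ^ n.+1)%N%:R.
  rewrite -box_prod; apply: (lattice_sum_bound (@inj_id _)) => // l.
  by rewrite -[leRHS]mulr1 ler_wpM2l// lern1 leq_b1.
have fG1 : finitely_supported G1.
  apply: (@finitely_supported_box _ _ _ (fun=> (M' * N)%N)) => l.
  by rewrite pnatr_eq0 eqb0 negbK => /andP[/inbox].
have fG2 : finitely_supported G2.
  apply: (@finitely_supported_box _ _ _ (fun=> (M' * N)%N)) => l.
  by rewrite pnatr_eq0 eqb0 negbK => /andP[/inbox].
have fG3 : finitely_supported G3 by exact: finitely_supported_box G3box.
pose G l := G1 l + G2 l + G3 l.
have fG : finitely_supported G by
  apply/finitely_supportedD/fG3/finitely_supportedD.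
have sumG : lattice_sum G / N%:R ^+ n.+1 <= D / N%:R.
  rewrite ler_pdivrMr ?exprn_gt0// exprS mulrA divfK ?gt_eqF//.
  rewrite /G !lattice_sumD//; last exact: finitely_supportedD.
  apply: (@le_trans _ _ (2 * ((M' * N).*2.+1 ^ n * a.*2.+1)%N%:R + K / N%:R *
    ((M' * N).*2.+1 ^ n.+1)%N%:R)); first lra.
  have dle : (M' * N).*2.+1%:R <= (3 * M')%:R * N%:R :> R.
    by rewrite -natrM ler_nat double_le.
  have de e : ((M' * N).*2.+1 ^ e)%N%:R <= (3 * M')%:R ^+ e * N%:R ^+ e :> R.
    by rewrite natrX -exprMn lerXn2r ?nnegrE// mulr_ge0.
  rewrite /D [leRHS]mulrDl; apply: lerD.
    rewrite natrM -[leRHS]mulrA ler_wpM2l// [leRHS]mulrAC ler_wpM2r//.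
  apply: le_trans (ler_wpM2l KN (de n.+1)) _.
  rewrite (exprS N%:R) le_eqVlt; apply/orP; left; apply/eqP; field.
  by rewrite gt_eqF.
have TG k : `|weighted Y N k - weighted X N (phi k)| <= G (phi k).
  rewrite /weighted YX; set v := A *m zvec k; set w := zvec (phi k).
  have -> : weight N (zvec k) = weight N v by rewrite /weight LA.
  have vw i : `|v i 0 - w i 0| <= c%:R by exact: Cc.
  have G10 l : 0 <= G1 l by [].
  have G20 l : 0 <= G2 l by [].
  have G30 l : 0 <= G3 l by rewrite mulr_ge0.
  have T01 x : 0 <= X x * weight N x <= 1.
    rewrite mulr_ge0 ?weight_ge0//=; last by case/andP: (X01 x).
    have [->|/XL h] := eqVneq (X x) 0; first by rewrite mul0r ler01.
    rewrite -[leRHS]mulr1; apply: ler_pM; rewrite ?weight_ge0 ?weight_le1//.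
    - by case/andP: (X01 x).
    - by case/andP: (X01 x).
    - exact: spacelike_ge0 L1 h.
  have Tdiff : `|X v * weight N v - X w * weight N w| <= 1.
    by have := T01 v; have := T01 w; rewrite ler_norml; lra.
  (* Away from both zero sets the signs of [s] and [s'] agree at [v] and [w]. *)
  have core : (forall i, `|w i 0| <= (M' * N)%:R) ->
      `|X v * weight N v - X w * weight N w| <= G (phi k).
    move=> wb; have wI : inb (phi k).
      apply/forallP => i; have := wb i; rewrite mxE -intr_norm -abszE.
      by rewrite -[(_)%:~R]/((absz _)%:R) ler_nat.
    have [s1|s1] := boolP (`|s w| <= a%:R).
      apply: le_trans Tdiff _; rewrite /G /G1 wI s1 /= -addrA lerDl addr_ge0//.
    have [s2|s2] := boolP (`|s' w| <= a%:R).
      apply: le_trans Tdiff _; rewrite /G /G2 wI s2 /=.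
      by rewrite [X in X + _]addrC -addrA lerDl addr_ge0.
    have sgn s0 : time_function s0 -> ~~ (`|s0 w| <= a%:R) ->
      (0 < s0 v) = (0 < s0 w).
      move=> S0; rewrite -ltNge lter_normr => /orP h.
      have := tf_coord_lip S0 vw; rewrite -natrM -natrM -/a ler_norml =>
        /andP[h1 h2].
      have [g0|g0] := ltP 0 (s0 w); first by have a0 := ler0n R a; lra.
      by apply/negbTE; rewrite -leNgt; have a0 := ler0n R a; lra.
    have -> : X v = X w by rewrite /X /separates (sgn _ S s1) (sgn _ S' s2).
    rewrite -mulrBr normrM; apply: (@le_trans _ _ `|weight N v - weight N w|).
      rewrite -[leRHS]mul1r ler_wpM2r// ger0_norm; by case/andP: (X01 w).
    apply: (@le_trans _ _ (K / N%:R)); last first.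
      by rewrite /G /G3 wI mulr1 lerDr addr_ge0.
    apply: le_trans (weight_lip N v w) _.
    rewrite ler_pdivrMr ?exprn_gt0// expr2 mulrA divfK ?gt_eqF//.
    pose d := v - w; have Ed : enorm d <= n.+1%:R * c%:R ^+ 2.
      by apply: enorm_le_coord => i; rewrite /d [(v - w) i 0]mxE [(- w) i 0]mxE.
    have Ew : enorm w <= n.+1%:R * (M' * N)%:R ^+ 2 by exact: enorm_le_coord.
    have -> : ldot v v - ldot w w = 2 * ldot w d + ldot d d.
      by rewrite /d !ldotE (ldotC v w); ring.
    have Y1 := ldot_Young w d N%:R; have Y2 := ldot_abs_le d.
    have N1 : 1 <= N%:R :> R by rewrite ler1n.
    rewrite -(ler_pM2l N0'); apply: le_trans (_ :
      enorm w + N%:R ^+ 2 * enorm d + N%:R * enorm d <= _).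
      apply: (@le_trans _ _ (N%:R * (2 * `|ldot w d| + `|ldot d d|))).
        by rewrite ler_pM2l// (le_trans (ler_normD _ _))// normrM ger0_norm.
      nra.
    have E0 := enorm_ge0 d.
    have NE : N%:R * enorm d <= N%:R ^+ 2 * enorm d.
      by rewrite ler_wpM2r// expr2 ler_peMr.
    apply: (@le_trans _ _ (enorm w + 2 * (N%:R ^+ 2 * enorm d))).
      by clear -NE; lra.
    apply: (@le_trans _ _ (n.+1%:R * (M' * N)%:R ^+ 2 + 2 * (N%:R ^+ 2 *
      (n.+1%:R * c%:R ^+ 2)))).
      apply: lerD => //; rewrite ler_pM2l// ler_wpM2l ?sqr_ge0//.
    by rewrite natrM le_eqVlt; apply/orP; left; apply/eqP; rewrite /K; ring.
  have Enear x : X x * weight N x != 0 -> forall i, `|x i 0| <= (M * N)%:R.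
    rewrite mulf_eq0 negb_or => /andP[/XL Ex /(weight_neq0 N0) Qx] i.
    rewrite -(ler_pXn2r (ltn0Sn 1)) ?nnegrE// real_normK ?num_real//.
    apply: le_trans (coord_enorm x i) _; apply: le_trans Ex _.
    rewrite natrM exprMn; apply: le_trans (_ : L * N%:R ^+ 2 <= _).
      by rewrite ler_wpM2l//; lra.
    by rewrite ler_wpM2r// sqr_ge0.
  have wbound : X v * weight N v != 0 \/ X w * weight N w != 0 ->
      forall i, `|w i 0| <= (M' * N)%:R.
    move=> h i; have N1 : 1 <= N%:R :> R by rewrite ler1n.
    have c0 : 0 <= c%:R :> R by [].
    rewrite natrM natrD; have [hv|hw] := h.
      have := Enear v hv i; have := vw i; rewrite natrM !ler_norml; nra.
    have := Enear w hw i; rewrite natrM => /le_trans; apply; nra.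
  have [vz|vz] := eqVneq (X v * weight N v) 0; last first.
    exact: core (wbound (or_introl vz)).
  have [wz|wz] := eqVneq (X w * weight N w) 0; last first.
    exact: core (wbound (or_intror wz)).
  by rewrite vz wz subrr normr0 !addr_ge0.
(* Summing [TG] over the lattice. *)
have ND k : weighted Y N k <= weighted X N (phi k) + G (phi k).
  by have := TG k; rewrite ler_norml; lra.
have ND' k : weighted X N (phi k) <= weighted Y N k + G (phi k).
  by have := TG k; rewrite ler_norml; lra.
have fX := weighted_finite N0 admX; have fY := weighted_finite N0 admY.
have fXp := finitely_supported_comp bphi fX.
have fGp := finitely_supported_comp bphi fG.
have S1 := lattice_sum_le fY (finitely_supportedD fXp fGp) ND.
have S2 := lattice_sum_le fXp (finitely_supportedD fY fGp) ND'.
have RX := lattice_sum_reindex (weighted X N) bphi.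
have RG := lattice_sum_reindex G bphi.
rewrite (lattice_sumD fXp fGp) RX RG in S1.
rewrite (lattice_sumD fY fGp) RX RG in S2.
apply: le_trans sumG; rewrite /avg_seq -mulrBl normrM.
rewrite [X in _ * X <= _]ger0_norm ?invr_ge0 ?exprn_ge0//.
by rewrite ler_wpM2r ?invr_ge0 ?exprn_ge0// ler_norml; lra.
Unshelve. all: by end_near. Qed.

End Invariance.

(** * The median space *)

Section Horizon.
Context {R : realType} {n : nat}.
Implicit Types s : 'cV[R]_n.+1 -> R.

Definition horizon s := time_function s /\ exists2 L, 1 <= L & pinched L s.

Lemma horizon3 s1 s2 s3 : horizon s1 -> horizon s2 -> horizon s3 ->
  exists L, [/\ 1 <= L, pinched L s1, pinched L s2 & pinched L s3].
Proof.
move=> [S1 [L1 l1 P1]] [S2 [L2 l2 P2]] [S3 [L3 l3 P3]].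
exists (L1 + L2 + L3); split; first by lra.
- by apply: pinched_le P1; lra.
- by apply: pinched_le P2; lra.
- by apply: pinched_le P3; lra.
Qed.

Lemma horizon_tm : horizon (tm : 'cV[R]_n.+1 -> R).
Proof. by split; [exact: tf_tm|exists 1; last exact: pinched_tm]. Qed.

Lemma horizon_med s1 s2 s3 : horizon s1 -> horizon s2 -> horizon s3 ->
  horizon (fun v => med (s1 v) (s2 v) (s3 v)).
Proof.
move=> h1 h2 h3; have [L [L1 P1 P2 P3]] := horizon3 h1 h2 h3.
split; first by apply: tf_med; [case: h1|case: h2|case: h3].
by exists L => //; exact: pinched_med.
Qed.

Lemma horizon_act (g : SO R n) s : horizon s -> horizon (tf_act g s).
Proof.
move=> [S [L L1 P]]; split; first exact: tf_act_time_function.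
have [N gN] := entries_le_exists g.
have gM : entries_le (N + 1) g.
  by move=> i j; apply: le_trans (gN i j) _; rewrite lerDl.
have N0 : 0 <= N by apply: le_trans (normr_ge0 _) (gN 0 0).
exists ((n.+1%:R * (N + 1)) ^+ 2 * L); last by apply: tf_act_pinched => //; lra.
have m1 : 1 <= n.+1%:R :> R by rewrite ler1n.
have : 1 <= n.+1%:R * (N + 1) by nra.
move=> h; have : 1 <= (n.+1%:R * (N + 1)) ^+ 2 by nra.
nra.
Qed.

Lemma horizon_triangle s1 s2 s3 : horizon s1 -> horizon s2 -> horizon s3 ->
  hdist s1 s3 <= hdist s1 s2 + hdist s2 s3.
Proof.
move=> h1 h2 h3; have [L [L1 P1 P2 P3]] := horizon3 h1 h2 h3.
by case: h1 h2 h3 => S1 _ [S2 _] [S3 _]; exact: (hdist_triangle L1).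
Qed.

Lemma hdist_ge0 s1 s2 : horizon s1 -> horizon s2 -> 0 <= hdist s1 s2.
Proof.
move=> h1 h2; have := horizon_triangle h1 h2 h1.
by rewrite hdistxx (hdistC s2); lra.
Qed.

End Horizon.

Section Model.
Context {R : realType} {k : nat} (n : 'I_k -> nat).

Record model := Model {
  mfun :> forall i, 'cV[R]_(n i).+1 -> R;
  mhorizon : forall i, horizon (@mfun i) }.
Arguments mfun : clear implicits.
Arguments mfun m i v : rename.

HB.instance Definition _ := gen_eqMixin model.
HB.instance Definition _ := gen_choiceMixin model.

Implicit Types x y z : model.

Lemma model_eq x y : (forall i v, x i v = y i v) -> x = y.
Proof.
case: x y => [f hf] [g hg] /= e.
have fg : f = g by apply: functional_extensionality_dep => i; apply/funext => v.
by move: hf hg; rewrite fg => hf hg; congr Model; exact: Prop_irrelevance.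
Qed.

Definition model_dist x y : R := \sum_i hdist (x i) (y i).

Lemma model_distxx x : model_dist x x = 0.
Proof. by apply: big1 => i _; exact: hdistxx. Qed.

Lemma model_distC x y : model_dist x y = model_dist y x.
Proof. by apply: eq_bigr => i _; exact: hdistC. Qed.

Lemma model_dist_triangle y x z :
  model_dist x z <= model_dist x y + model_dist y z.
Proof.
rewrite -big_split; apply: ler_sum => i _ /=.
by apply: horizon_triangle; exact: mhorizon.
Qed.

Lemma model_dist_eq0 x y : model_dist x y = 0 -> x = y.
Proof.
move=> /eqP; rewrite psumr_eq0 => [/allP e|i _]; last first.
  by apply: hdist_ge0; exact: mhorizon.
apply: model_eq => i v; have /eqP xy := e i (mem_index_enum i).
have [L [L1 Px Py _]] := horizon3 (mhorizon x i) (mhorizon y i) (mhorizon x i).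
by rewrite (hdist_eq0 L1 (mhorizon x i).1 (mhorizon y i).1 Px Py xy).
Qed.

HB.instance Definition _ := isMetric.Build R model
  model_distxx model_dist_eq0 model_distC model_dist_triangle.

Lemma mdistE x y : mdist x y = model_dist x y.
Proof. by []. Qed.

Lemma med_btw3 (f : 'I_3 -> R) (i j : 'I_3) : i != j ->
  btw (f i) (med (f 0) (f 1) (f 2%:R)) (f j).
Proof.
have [h1 h2 h3] := med_btw (f 0) (f 1) (f 2%:R).
have E (l : 'I_3) : [\/ l = 0, l = 1 | l = 2%:R].
  case: l => [[|[|[|//]]] l3]; [apply: Or31|apply: Or32|apply: Or33];
    exact: val_inj.
by case: (E i) => ->; case: (E j) => ->; rewrite ?eqxx// 1?btwC.
Qed.

(** The deficit in the triangle inequality is a sum of nonnegative deficits, one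
    for each factor. *)
Lemma model_dist_btw x y z : (forall i v, btw (x i v) (y i v) (z i v)) <->
  model_dist x y + model_dist y z = model_dist x z.
Proof.
split=> [H|e i v].
  rewrite -big_split; apply: eq_bigr => i _ /=.
  have [L [L1 Px Py Pz]] :=
    horizon3 (mhorizon x i) (mhorizon y i) (mhorizon z i).
  apply: (hdist_btw L1 _ _ _ Px Py Pz) => //; exact: (mhorizon _ _).1.
have [L [L1 Px Py Pz]] := horizon3 (mhorizon x i) (mhorizon y i) (mhorizon z i).
apply: (hdist_btw_inv L1 (mhorizon x i).1 (mhorizon y i).1 (mhorizon z i).1 Px
  Py Pz).
apply/eqP; rewrite -subr_eq0; apply/eqP.
have : \sum_j (hdist (x j) (y j) + hdist (y j) (z j) - hdist (x j) (z j)) = 0.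
  by rewrite big_split /= sumrN big_split /= -[X in X - _]/(model_dist x y +
    model_dist y z) e subrr.
move=> /eqP; rewrite psumr_eq0 => [/allP/(_ i (mem_index_enum i))/eqP //|j _].
by rewrite subr_ge0; apply: horizon_triangle; exact: mhorizon.
Qed.

Lemma model_median : median_space model.
Proof.
split; first by exists (Model (fun i => horizon_tm)).
move=> x; exists (Model (fun i => horizon_med (mhorizon (x 0) i)
  (mhorizon (x 1) i) (mhorizon (x 2%:R) i))); split.
  move=> i j ij; rewrite !mdistE; apply/model_dist_btw => l v /=.
  exact: (med_btw3 (fun a => x a l v)).
move=> m mP; apply: model_eq => i v /=; apply/esym.
have B (a b : 'I_3) : a != b -> btw (x a i v) (m i v) (x b i v).
  by move=> /mP; rewrite !mdistE => /model_dist_btw.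
by apply: med_unique; exact: B.
Qed.

Lemma unit_cube_net m (r : R) : 0 < r ->
  exists (T : finType) (p : T -> 'cV[R]_m), forall v : 'cV[R]_m,
    (forall i, `|v i 0| <= 1) -> exists t, forall i, `|v i 0 - p t i 0| <= r.
Proof.
move=> r0; pose J := (Num.bound r^-1).+1.
have J0 : 0 < J%:R :> R by rewrite ltr0n.
have Jr : J%:R^-1 <= r.
  rewrite -[leRHS]invrK lef_pV2 ?posrE ?invr_gt0//.
  apply/ltW/(lt_le_trans (archi_boundP _)); first by rewrite invr_ge0 ltW.
  by rewrite ler_nat leqnSn.
exists {ffun 'I_m -> 'I_(2 * J).+1}.
exists (fun t : {ffun 'I_m -> 'I_(2 * J).+1} =>
  \col_i (((t i : nat)%:R - J%:R) / J%:R)) => v v1.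
exists [ffun i => inord (absz (Num.floor (J%:R * v i 0) + J%:Z)%R)] => i.
have := v1 i; rewrite ler_norml => /andP[h1 h2].
set f := Num.floor (J%:R * v i 0);
  have /andP[f1 f2] := floor_itv (J%:R * v i 0).
rewrite -/f intrD in f1 f2.
have f3 : 0 <= f + J%:Z.
  have : (-1)%:~R < (f + J%:Z)%:~R :> R.
    by rewrite intrD -[(Posz J)%:~R]/(J%:R) intrN; nra.
  by rewrite ltr_int; lia.
have f4 : f + J%:Z <= (2 * J)%:Z.
  rewrite -(ler_int R) intrD -[(Posz J)%:~R]/(J%:R) -[(Posz _)%:~R]/((2 * J)%:R)
    natrM; nra.
rewrite !mxE ffunE inordK; last by rewrite ltnS -lez_nat gez0_abs.
have -> : (absz (f + J%:Z)%R)%:R = f%:~R + J%:R :> R.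
  by rewrite -[LHS]/((Posz (absz _))%:~R) gez0_abs// intrD.
rewrite addrK; apply: le_trans Jr.
have -> : v i 0 - f%:~R / J%:R = (J%:R * v i 0 - f%:~R) / J%:R by field;
  rewrite gt_eqF.
rewrite normrM [X in _ * X]gtr0_norm ?invr_gt0// ler_pdivrMr// mulVf ?gt_eqF//.
by rewrite ler_norml; lra.
Qed.

Definition model_ball L := [set x : model | forall i, pinched L (x i)].

Lemma tf_abs_le m (s : 'cV[R]_m.+1 -> R) v : time_function s ->
  `|s v| <= 2 * (enorm v + 1).
Proof.
move=> S; rewrite -[s v]subr0 -(tf0 S); have e0 := enorm_ge0 v.
by apply: tf_lip => //; rewrite ?subr0; nra.
Qed.

(** Compactness by pointwise limits along ultrafilters: the conditions defining
    [model_ball] pass to the limit, and as all time functions are Lipschitz,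
    pointwise convergence is uniform on the unit cube. *)
Lemma model_ball_compact L : 1 <= L -> compact (model_ball L).
Proof.
move=> L1; rewrite compact_ultra => F UF FL.
have PF : ProperFilter F by exact: (@ultra_proper _ F).
have lims (i : 'I_k) (v : 'cV[R]_(n i).+1) :
    exists l : R, (fun x : model => x i v) @ F --> l.
  apply: (@ultra_bounded_cvg _ _ _ _ (2 * (enorm v + 1))); apply: nearW => x.
  by apply: tf_abs_le; exact: (mhorizon x i).1.
have {lims}[s sP] : exists s : forall i, 'cV[R]_(n i).+1 -> R,
    forall i v, (fun x : model => x i v) @ F --> s i v.
  exists (fun i v => sval (cid (lims i v))) => i v;
    exact: (svalP (cid (lims i v))).
have uniq (l l' : R^o) (h h' : model -> R^o) : h @ F --> l -> h' @ F --> l' ->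
    (forall x, h x = h' x) -> l = l'.
  move=> hl hl' e; have hh : h = h' by apply/funext.
  by rewrite hh in hl; exact: cvg_unique hl hl'.
have tfs i : time_function (s i).
  split=> [v r|r v|v w cw].
  - apply: (@uniq _ _ (fun x : model => x i (v + r *: tvec))
      (fun x => x i v + r)) => //.
      by apply: cvgD; [exact: sP|exact: cvg_cst].
    by move=> x; rewrite (tf_shift (mhorizon x i).1).
  - apply: (@uniq _ _ (fun x : model => x i (r *: v))
      (fun x => r * x i v)) => //.
      by apply: cvgMl_tmp; exact: sP.
    by move=> x; rewrite (tf_scale (mhorizon x i).1).
  - apply: ler_cvg_to (sP i v) (sP i (v + w)) _; apply: nearW => x.
    exact: (tf_mono (mhorizon x i).1).
have pins i : pinched L (s i).
  apply/(pinchedP L1 (tfs i)) => v.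
  have cv : (L + 1) * (tm v - (x : model) i v) ^+ 2 @[x --> F] -->
      (L + 1) * (tm v - s i v) ^+ 2.
    apply: cvgMl_tmp; rewrite expr2.
    have c1 : tm v - (x : model) i v @[x --> F] --> tm v - s i v.
      by apply: cvgB; [exact: cvg_cst|exact: sP].
    by under eq_fun do rewrite expr2; apply: cvgM.
  apply: cvgr_to_le cv _; apply: filterS FL => x /(_ i) Px.
  exact: tf_pinched (mhorizon x i).1 Px.
pose x0 : model := Model (fun i => conj (tfs i) (ex_intro2 _ _ L L1 (pins i))).
exists x0; split=> //.
apply/cvg_ballP => eps eps0.
pose K : R := k.+1%:R; have K0 : 0 < K by rewrite ltr0n.
(* One test point in each cell of a fine grid controls the whole cube. *)
have near_i i : \forall x \near F, hdist (s i) ((x : model) i) <= eps / 2 / K.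
  have [C C0 HC] := @hdist_small R (n i) L L1.
  pose d := eps / 2 / K / C; have d0 : 0 < d by rewrite !divr_gt0.
  pose m : R := (n i).+1%:R; have m0 : 0 < m by rewrite ltr0n.
  pose r := d / (6 * m); have r0 : 0 < r by rewrite divr_gt0// mulr_gt0.
  have rE : 2 * m * r = d / 3 by rewrite /r; field; rewrite gt_eqF.
  have [T [p net]] := unit_cube_net (n i).+1 r0.
  have : \forall x \near F, forall t,
    `|s i (p t) - (x : model) i (p t)| <= d / 3.
    apply: filter_forall => t; have d3 : 0 < d / 3 by rewrite divr_gt0.
    exact: (cvgrPdist_le _ _).1 (sP i (p t)) _ d3.
  apply: filterS2 FL => x xL xp.
  have -> : eps / 2 / K = C * d by rewrite /d; field; rewrite !gt_eqF.
  apply: HC => //; first exact: (mhorizon x i).1.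
  move=> v v1; have [t vt] := net v v1.
  have h1 := tf_coord_lip (tfs i) vt;
    have h2 := tf_coord_lip (mhorizon x i).1 vt.
  have h3 := xp t; move: h1 h2 h3;
    rewrite rE !ler_norml => /andP[? ?] /andP[? ?] /andP[? ?].
  by apply/andP; split; lra.
have : \forall x \near F, forall i, hdist (s i) ((x : model) i) <= eps / 2 / K.
  by apply: filter_forall => i; exact: near_i.
apply: filterS => x xs; rewrite ballEmdist /= mdistE /model_dist.
apply: (@le_lt_trans _ _ (\sum_(i < k) eps / 2 / K));
  first by apply: ler_sum => i _; exact: xs.
rewrite sumr_const card_ord -[X in X < _]mulr_natr.
have -> : eps / 2 / K * k%:R = eps / 2 * (K^-1 * k%:R) by ring.
have : K^-1 * k%:R <= 1 by rewrite ler_pdivrMl// mulr1 ler_nat.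
move=> q1; apply: (@le_lt_trans _ _ (eps / 2)); last by lra.
by rewrite ler_piMr//; lra.
Qed.

End Model.

(** * Lattices in the product group *)

Section ProductGroup.
Context {R : realType} {k : nat} (n : 'I_k -> nat).
Implicit Types (g h : SO_prod R n) (N : R).

Definition coordinate g (i : 'I_k) : SO R (n i) := g i.

Definition bounded_entries N g := forall i, entries_le N (coordinate g i).

Lemma coordinateM g h i : coordinate (g * h)%g i =
  (coordinate g i * coordinate h i)%g.
Proof. by []. Qed.

Lemma coordinateV g i : coordinate g^-1%g i = (coordinate g i)^-1%g.
Proof. by []. Qed.

Lemma bounded_entriesV N g : bounded_entries N g -> bounded_entries N g^-1%g.
Proof. by move=> gN i; rewrite coordinateV; exact: entries_leV. Qed.

Lemma bounded_entries_exists g : exists N, bounded_entries N g.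
Proof.
have [f fP] := choice (fun i => entries_le_exists (coordinate g i)).
have f0 i : 0 <= f i by apply: le_trans (normr_ge0 _) (fP i 0 0).
exists (\sum_i f i) => i a b; apply: le_trans (fP i a b) _.
by rewrite (bigD1 i)//= lerDl sumr_ge0.
Qed.

Lemma entry_continuous i a b :
  continuous (fun g : SO_prod R n => val (coordinate g i) a b).
Proof.
move=> g.
apply: (@continuous_comp _ _ _ (fun g : SO_prod R n => coordinate g i)
  (fun A : SO R (n i) => val A a b)); first exact: proj_continuous.
apply: (@continuous_comp _ _ _ (val : SO R (n i) -> _) (fun M => M a b)).
  exact: initial_continuous.
exact: coord_continuous.
Qed.

Lemma nbhs_bounded_entries N g : bounded_entries N g ->
  \forall h \near g, bounded_entries (N + 1) h.
Proof.
move=> gN; pose f i a b (h : SO_prod R n) :=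
  `|val (coordinate h i) a b| <= N + 1.
apply: (@filter_forall _ _ (fun i h =>
  forall a b, f i a b h) _ (nbhs_filter g)) => i.
apply: (@filter_forall _ _ (fun a h =>
  forall b, f i a b h) _ (nbhs_filter g)) => a.
apply: (@filter_forall _ _ (fun b h => f i a b h) _ (nbhs_filter g)) => b.
have /cvgrPdist_lt /(_ 1 ltr01) := @entry_continuous i a b g.
apply: filterS => h /= hg; rewrite /f -[val (coordinate h i) a b](subrK (val
  (coordinate g i) a b)).
rewrite addrC; apply: le_trans (ler_normD _ _) (lerD (gN i a b) _).
by rewrite distrC ltW.
Qed.

(** Unfolds the product topology and the subspace topology on each factor at the
    identity. *)
Lemma nbhs1_entries (V : set (SO_prod R n)) : nbhs (1%g : SO_prod R n) V ->
  exists2 eta : R, 0 < eta & forall g,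
    (forall i a b, `|val (coordinate g i) a b - (1%:M :
      'M[R]_((n i).+1)) a b| < eta) -> V g.
Proof.
pose E (eta : R) := [set g : SO_prod R n | forall i a b,
  `|val (coordinate g i) a b - (1%:M : 'M[R]_((n i).+1)) a b| < eta].
pose F := filter_from [set eta : R | 0 < eta] E.
have FF : Filter F.
  apply: filter_from_filter; first by exists 1; exact: ltr01.
  move=> e1 e2 e10 e20; exists (Num.min e1 e2); first by rewrite /= lt_min e10.
  by move=> g gE; split=> i a b; have := gE i a b; rewrite lt_min => /andP[].
suff : F --> (1%g : SO_prod R n) by move=> /[apply] -[eta eta0 H];
  exists eta => // g gE; exact: H.
apply/cvg_sup => i A; rewrite nbhsE => -[B [[C oC <-] C1] CA].
move: C1 oC => /= C1 [D oD DC].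
have D1 : nbhs (1%:M : 'M[R]_((n i).+1)) D.
  by apply: open_nbhs_nbhs; split=> //; move: C1; rewrite -DC.
have [eta eta0 HD] := (nbhs_ballP _ _).1 D1.
exists eta => // g gE; apply: CA; rewrite -DC /=; apply: HD; split=> // a b.
by rewrite /ball /= distrC; exact: gE.
Qed.

End ProductGroup.

Section Lattice.
Context {R : realType} {k : nat} (n : 'I_k -> nat).
Context (Gamma : groupClosed (SO_prod R n)).

(** Two elements with bounded and nearly equal entries have a quotient close to
    the identity, so in a discrete subgroup they coincide; the pigeonhole
    principle on a grid of mesh [de] concludes. *)
Lemma discrete_bounded_finite N :
  [set` Gamma] `<=` isolated [set` Gamma] ->
  finite_set [set g : subgroup Gamma | bounded_entries N (val g)].
Proof.
have G1 : [set` Gamma] (1%g : SO_prod R n) by exact: gpred1.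
move=> /(_ _ G1) [_ [V V1 VG]].
have [eta eta0 HV] := nbhs1_entries V1.
pose N' : R := `|N| + 1; have N'0 : 0 < N' by rewrite ltr_wpDl.
pose m : R := \sum_i (n i).+1%:R + 1.
have m0 : 0 < m by rewrite ltr_wpDl// sumr_ge0.
pose de := eta / (2 * m * N'); have de0 : 0 < de
  by rewrite divr_gt0// !mulr_gt0.
pose P := Num.bound (2 * N' / de).
pose T := {i : 'I_k & ('I_(n i).+1 * 'I_(n i).+1)%type}.
pose cell (g : subgroup Gamma) : {ffun T -> 'I_P.+1} :=
  [ffun t => inord (absz (Num.floor ((val (coordinate (val g) (tag t)) (tagged
    t).1 (tagged t).2 + N') / de)))].
have cell_inj (g h : subgroup Gamma) : bounded_entries N (val g) ->
  bounded_entries N (val h) ->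
    cell g = cell h -> g = h.
  move=> gN hN gh.
  have close i a b : `|val (coordinate (val h) i) a b - val (coordinate (val g)
    i) a b| <= de.
    have := congr1 (fun f : {ffun T -> 'I_P.+1} =>
      val (f (Tagged _ (a, b) : T))) gh.
    rewrite !ffunE /=.
    set x := val (coordinate (val g) i) a b;
      set y := val (coordinate (val h) i) a b.
    have fl z : `|z| <= N -> (absz (Num.floor ((z + N') / de)) < P.+1)%N /\
        (absz (Num.floor ((z + N') / de)))%:Z = Num.floor ((z + N') / de).
      move=> zN; have /andP[z1 z2] : - N' <= z <= N'.
        rewrite -ler_norml; apply: le_trans zN _.
        by apply: le_trans (ler_norm N) _; rewrite lerDl.
      have q0 : 0 <= (z + N') / de by apply: divr_ge0; [lra|exact: ltW].
      have f0 : 0 <= Num.floor ((z + N') / de) by rewrite floor_ge_int.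
      split; last by rewrite gez0_abs.
      rewrite ltnS -(ler_nat R) -[X in X <= _]/((Posz (absz _))%:~R) gez0_abs//.
      apply: le_trans (floor_le _) _;
        apply/ltW/(le_lt_trans _ (archi_boundP _)).
        by rewrite ler_pM2r ?invr_gt0//; lra.
      by apply: divr_ge0; [rewrite mulr_ge0// ltW|exact: ltW].
    have [x1 x2] := fl x (gN i a b); have [y1 y2] := fl y (hN i a b).
    rewrite !inordK// => /(congr1 Posz); rewrite x2 y2 => e.
    have /andP[u1 u2] := floor_itv ((x + N') / de);
      have /andP[v1 v2] := floor_itv ((y + N') / de).
    rewrite e intrD in u1 u2; rewrite intrD in v2.
    have d1 : `|(y + N') / de - (x + N') / de| <= 1 by rewrite ler_norml; lra.
    have -> : y - x = ((y + N') / de - (x + N') / de) * de by field;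
      rewrite gt_eqF.
    by rewrite normrM (gtr0_norm de0) ler_piMl// ltW.
  have gh1 : (g^-1 * h)%g = 1%g.
    apply: val_inj; have VGh : (V `&` [set` Gamma]) (val (g^-1 * h)%g).
      split; last exact: (svalP (g^-1 * h)%g).
      apply: HV => i a b.
      have -> : val (coordinate (val (g^-1 * h)%g) i) =
          val (coordinate (val g) i)^-1%g *m val (coordinate (val h) i) by [].
      have g1 : val (coordinate (val g) i)^-1%g *m val (coordinate (val g) i) =
        1%:M.
        by rewrite -[LHS]/(val ((coordinate (val g) i)^-1 * coordinate (val g)
          i)%g) mulVg.
      rewrite -g1; set A := val (coordinate (val g) i)^-1%g;
        set B := val (coordinate (val h) i).
      set C := val (coordinate (val g) i).
      have -> : (A *m B) a b - (A *m C) a b = (A *m (B - C)) a b.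
        by rewrite mulmxBr [RHS]mxE [X in _ = _ + X]mxE.
      rewrite mxE; apply: le_lt_trans (ler_norm_sum _ _ _) _.
      apply: (@le_lt_trans _ _ (\sum_(j < (n i).+1) N' * de)).
        apply: ler_sum => j _; rewrite normrM; apply: ler_pM => //.
          rewrite val_inv_norm; apply: le_trans (gN i _ _) _.
          by apply: le_trans (ler_norm N) _; rewrite lerDl.
        by rewrite [(B - C) j b]mxE [(- C) j b]mxE; exact: close.
      rewrite sumr_const card_ord -[X in X < _]mulr_natl.
      have nm : (n i).+1%:R <= m.
        by rewrite /m (bigD1 i)//= -addrA lerDl addr_ge0// sumr_ge0.
      apply: (@le_lt_trans _ _ (m * (N' * de)));
        first by rewrite ler_wpM2r// ltW// mulr_gt0.
      have -> : m * (N' * de) = eta / 2 by rewrite /de; field; rewrite !gt_eqF.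
      by rewrite ltr_pdivrMr//; lra.
    by move: VGh; rewrite VG => ->.
  by apply/(mulgI g^-1%g); rewrite gh1 mulVg.
apply: contrapT => /(infinite_set_fset #|{ffun T -> 'I_P.+1}|.+1)[D DS].
rewrite leqNgt => /negP; apply; rewrite ltnS -(size_map cell) cardE.
apply: uniq_leq_size; last by move=> x _; rewrite mem_enum.
rewrite map_inj_in_uniq ?finmap.fset_uniq// => x y xD yD.
by apply: cell_inj; [exact: DS|exact: DS].
Qed.

(** The images in the coset space of the sets of matrices with entries less than
    [N] form an increasing sequence of open sets, the projection being open. *)
Lemma cocompact_bounded : compact [set: coset_space Gamma] ->
  exists N : R, forall g : SO_prod R n, exists2 c,
    c \in Gamma & bounded_entries N (g * c)%g.
Proof.
move=> /compact_near_coveringP cpt.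
pose Q := coset_space Gamma.
pose P (N : nat) (q : Q) := exists2 g, \pi_Q%qT g = q & bounded_entries N%:R g.
have [] := cpt nat \oo P _.
  move=> q _; have [N0 HN0] := bounded_entries_exists (repr q).
  pose N1 := Num.bound `|N0|.
  have HN1 : bounded_entries N1%:R (repr q).
    move=> i a b; apply: le_trans (HN0 i a b) _; apply: le_trans (ler_norm _) _.
    exact/ltW/archi_boundP.
  pose U := [set h : SO_prod R n | bounded_entries (N1%:R + 1) h].
  pose W := [set q' : Q | exists2 g, \pi_Q%qT g = q' & U^° g].
  have Wq : nbhs q W.
    apply: open_nbhs_nbhs; split; last first.
      by exists (repr q); [exact: reprK|exact: nbhs_bounded_entries].
    rewrite /open /= /quotient_open openE => g [u ug Uu].
    have ugG : (u^-1 * g)%g \in Gamma by exact/(@eqmodP _ (coset_equiv Gamma)).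
    pose c := (g^-1 * u)%g.
    have cG : c \in Gamma by rewrite /c -(invgK u) -invgM gpredV.
    have gc : (g * c)%g = u by rewrite /c mulgA mulgV mul1g.
    have cont : continuous (fun h : SO_prod R n => (h * c)%g).
      move=> h; apply: (@continuous_comp _ _ _ (fun h => (h, c)) (fun x =>
        (x.1 * x.2)%g)).
        exact: (@cvg_pair _ _ _ (nbhs h) (nbhs h) (nbhs c) _ _ _ id (cst c)
          cvg_id (cvg_cst c)).
      exact: mulg_continuous.
    have : nbhs g ((fun h : SO_prod R n => (h * c)%g) @^-1` U^°).
      by apply: cont; rewrite gc; apply: open_nbhs_nbhs; split=> //;
        exact: open_interior.
    apply: filterS => h Uh; exists (h * c)%g => //.
    apply/(@eqmodP _ (coset_equiv Gamma)); rewrite /= /coset_rel /=.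
    by rewrite invgM -mulgA mulVg mulg1 gpredV.
  have near_N : \forall N \near \oo, (N1.+1 <= N)%N by exact: nbhs_infty_ge.
  exists (W, [set N | (N1.+1 <= N)%N]); first by split.
  move=> [q' N] [/= [g gq Ug] NN]; exists g => //.
  move=> i a b; apply: le_trans (interior_subset Ug i a b) _.
  by rewrite natr1 ler_nat.
move=> N _ HN; exists N%:R => g.
have [] := HN N (leqnn N) (\pi_Q%qT g) I.
move=> h hg hN; exists (g^-1 * h)%g; last by rewrite mulgA mulgV mul1g.
exact/(@eqmodP _ (coset_equiv Gamma)).
Qed.

End Lattice.

(** * The action on the median space *)

Section ModelAction.
Context {R : realType} {k : nat} (n : 'I_k -> nat).
Implicit Types (g h : SO_prod R n) (x y : model (R := R) n) (L : R).

Definition model_act g x : model n :=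
  Model (fun i => horizon_act (coordinate g i) (mhorizon x i)).

Lemma model_act1 x : model_act 1%g x = x.
Proof.
apply: model_eq => i v /=; rewrite -[coordinate 1%g i]/(1%g : SO R (n i)).
by rewrite tf_act1//; case: (mhorizon x i).
Qed.

Lemma model_actM g h x : model_act (g * h)%g x = model_act g (model_act h x).
Proof.
apply: model_eq => i v /=; rewrite coordinateM tf_actM//.
by case: (mhorizon x i).
Qed.

Lemma model_act_isometry g x y :
  mdist (model_act g x) (model_act g y) = mdist x y.
Proof.
rewrite !mdistE; apply: eq_bigr => i _ /=.
have [L [L1 Px Py _]] := horizon3 (mhorizon x i) (mhorizon y i) (mhorizon x i).
exact: hdist_act (mhorizon x i).1 (mhorizon y i).1 Px Py.
Qed.

(** By [pinched_near] each ball is a neighbourhood of the smaller balls, so the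
    balls cover a compact set together with their interiors. *)
Lemma compact_model_ball (K : set (model (R := R) n)) : compact K ->
  exists2 L, 1 <= L & K `<=` model_ball L.
Proof.
move=> /compact_near_coveringP cpt.
have [] := cpt nat \oo (fun N x => model_ball (N%:R + 1) x) _.
  move=> x Kx.
  have pin i : exists L, 1 <= L /\ pinched L (x i).
    by have [_ [L L1 P]] := mhorizon x i; exists L.
  have [f fP] := choice pin.
  pose L := 1 + \sum_i f i.
  have f1 i : 1 <= f i by case: (fP i).
  have fL i : f i <= L.
    rewrite /L (bigD1 i)//= addrCA lerDl addr_ge0// sumr_ge0// => j _.
    by have := f1 j; lra.
  have L1 : 1 <= L by rewrite lerDl sumr_ge0// => j _; have := f1 j; lra.
  have xL i : pinched L (x i) by case: (fP i) => ? /pinched_le; exact.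
  have near_i i : exists e : R, 0 < e /\
      forall y : model n, hdist (x i) (y i) < e -> pinched (4 * (L + 1)) (y i).
    have [e e0 H] := @pinched_near R (n i) L L1; exists e; split=> // y xy.
    have [Sy [L' L1' Py]] := mhorizon y i.
    exact: (H _ _ L' (mhorizon x i).1 Sy (xL i) L1' Py xy).
  have [e eP] := choice near_i.
  pose W i := [set y : model n | hdist (x i) (y i) < e i].
  have Wx : \forall y \near x, forall i, W i y.
    apply: (@filter_forall _ _ W _ (nbhs_filter x)) => i.
    apply/nbhs_ballP; exists (e i); first by case: (eP i).
    move=> y; rewrite ballEmdist /= mdistE; apply: le_lt_trans.
    rewrite /model_dist (bigD1 i)//= lerDl sumr_ge0// => j _.
    by apply: hdist_ge0; exact: mhorizon.
  pose N0 := Num.bound (4 * (L + 1)).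
  have near_N : \forall N \near \oo, (N0 <= N)%N by exact: nbhs_infty_ge.
  exists ([set y | forall i, W i y], [set N | (N0 <= N)%N]); first by split.
  move=> [y N] /= [Wy NN] i.
  have P4 : pinched (4 * (L + 1)) (y i) by exact: (eP i).2 (Wy i).
  apply: pinched_le P4; first by lra.
  have b0 : 0 <= 4 * (L + 1) by lra.
  apply: (@le_trans _ _ N0%:R); first exact/ltW/archi_boundP.
  by apply: (@le_trans _ _ N%:R); rewrite ?lerDl// ler_nat.
move=> N _ HN; exists (N%:R + 1); first by rewrite lerDr.
by move=> x Kx; exact: (HN N (leqnn N) x Kx).
Qed.

End ModelAction.

Theorem corollary1p5 (R : realType) (k : nat) (n : 'I_k -> nat)
    (k_ge1 : (1 <= k)%N) (n_ge1 : forall i : 'I_k, (1 <= n i)%N)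
    (Gamma : groupClosed (SO_prod R n)) :
  uniform_lattice Gamma ->
  medianizable R (subgroup Gamma).
Proof.
move=> [disc cpt].
exists (model (R := R) n), (fun g x => model_act (val g) x).
split; first exact: model_median.
split.
- split; first by apply/funext => x; exact: model_act1.
  by move=> g h; apply/funext => x; rewrite /= -model_actM.
- by move=> g x y; exact: model_act_isometry.
- move=> K /compact_model_ball[L L1 KL].
  apply: sub_finite_set (discrete_bounded_finite (4 * (1 + 2 * L)) disc).
  move=> g [_ [[x Kx <-] Kgx]] i.
  exact: (tf_act_proper L1 (mhorizon x i).1 (KL _ Kx i) (KL _ Kgx i)).
have [N HN] := cocompact_bounded cpt.
pose N' : R := `|N| + 1; pose m : R := \sum_i (n i).+1%:R + 1.
pose L := (m * N') ^+ 2 * 19.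
have N1 : 1 <= N' by rewrite lerDr.
have m1 : 1 <= m by rewrite lerDr sumr_ge0.
have L1 : 1 <= L.
  have mN : 1 <= m * N' by nra.
  have mN2 : 1 <= (m * N') ^+ 2 by rewrite exprn_ege1.
  by rewrite /L; lra.
exists (model_ball L); first exact: model_ball_compact.
apply/seteqP; split=> // x _.
have near_base i : exists g : SO R (n i), pinched 19 (tf_act g (x i)).
  by have [Sx [Lx Lx1 Px]] := mhorizon x i; exact: tf_act_center Lx1 Sx Px.
pose h : SO_prod R n := fun i => sval (cid (near_base i)).
have [c cG hc] := HN h.
pose g : subgroup Gamma := Sub c cG.
exists g => //; exists (model_act (val g)^-1%g x); last first.
  by rewrite -model_actM mulgV model_act1.
(* [h] brings [x] near the base point, and [h * c] is bounded. *)
have -> : (val g)^-1%g = ((h * c)^-1 * h)%g by rewrite invgM -mulgA mulVg mulg1.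
rewrite model_actM => i.
have P19 : pinched 19 (model_act h x i) by exact: (svalP (cid (near_base i))).
have bN : bounded_entries N' (h * c)^-1%g.
  apply: bounded_entriesV => j a b; apply: le_trans (hc j a b) _.
  by apply: le_trans (ler_norm N) _; rewrite lerDl.
have P' := tf_act_pinched (bN i) (ler0n _ 19) (mhorizon (model_act h x) i).1
  P19.
have ni1 : 1 <= (n i).+1%:R :> R by rewrite ler1n.
have nm : (n i).+1%:R <= m.
  by rewrite /m (bigD1 i)//= -addrA lerDl addr_ge0// sumr_ge0.
have nN : 1 <= ((n i).+1%:R * N') ^+ 2 by rewrite exprn_ege1//; nra.
apply: pinched_le P'; first by lra.
rewrite /L ler_wpM2r// lerXn2r ?nnegrE ?mulr_ge0//; try lra.
by rewrite ler_wpM2r//; lra.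
Qed.
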